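(* Let $\mathcal H$ and $\hat{\mathcal H}$ be compact self-adjoint operators with non-negative eigenvalues on a separable real Hilbert space $\mathbb H$, and let $J$ be a finite index set with spectral gap $\gamma_J>0$ (all notation as defined in the context). If $\hat\alpha_J\le1/4$, then $$\sqrt{\sum_{k\in J}\Big\|\hat\psi_k-\sum_{\ell\in J}\langle\hat\psi_k,\psi_\ell\rangle\Big(\psi_\ell+\sum_{m\notin J}\frac{\langle(\hat{\mathcal H}-\mathcal H)\psi_\ell,\psi_m\rangle}{\lambda_\ell-\lambda_m}\psi_m\Big)\Big\|^2}\;\le\;\Big(\frac{74\sqrt D}{9}+8\Big)\hat\alpha_J\hat\beta_J .$$
   Context: $\mathbb H$ is a separable real Hilbert space with inner product $\langle\cdot,\cdot\rangle$ and norm $\|\cdot\|$; $\|\cdot\|_{\mathrm{op}}$ and $\|\cdot\|_{\mathrm{HS}}$ are the operator and Hilbert–Schmidt norms; $(u\otimes v)w=\langle v,w\rangle u$. $\mathcal H,\hat{\mathcal H}$ are compact self-adjoint operators on $\mathbb H$ whose eigenvalues are all non-negative. Write $\mathcal H=\sum_{k}\lambda_k\mathcal Q_k$, $\mathcal Q_k=\psi_k\otimes\psi_k$, with $\lambda_1\ge\lambda_2\ge\dots\ge0$ (repeated according to multiplicity) and orthonormal eigenvectors $\psi_k$; similarly $\hat{\mathcal H}=\sum_k\hat\lambda_k\hat{\mathcal Q}_k$, $\hat{\mathcal Q}_k=\hat\psi_k\otimes\hat\psi_k$, $\hat\lambda_1\ge\hat\lambda_2\ge\dots\ge0$. Both eigenvector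 systems are understood to be complete, $\sum_k\mathcal Q_k=\sum_k\hat{\mathcal Q}_k=$ identity: if the ordered sequence misses part of the kernel, an orthonormal basis of the remaining part of the kernel is adjoined with eigenvalue $0$, and is included in all sums over indices not in $J$. $J\subset\mathbb N$ is a finite nonempty index set with $\gamma_J:=\min_{k\in J,\ell\notin J}|\lambda_k-\lambda_\ell|>0$. $D$ is the number of distinct values among $\{\lambda_k\}_{k\in J}$. $\mathcal P_J=\sum_{k\in J}\mathcal Q_k$. Weighted perturbation quantities: with $$|\mathcal R|_J^{1/2}=\sum_{k\notin J}\frac{\mathcal Q_k}{\sqrt{\min_{m\in J}|\lambda_k-\lambda_m|}},\qquad \mathcal T_J^{1/2}=\frac{1}{\sqrt{\gamma_J}}\mathcal P_J+|\mathcal R|_J^{1/2},$$ set $\hat\alpha_J=\|\mathcal T_J^{1/2}(\hat{\mathcal H}-\mathcal H)\mathcal T_J^{1/2}\|_{\mathrm{op}}$ and $\hat\beta_J=\gamma_J^{-1/2}\||\mathcal R|_J^{1/2}(\hat{\mathcal H}-\mathcal H)\mathcal P_J\|_{\mathrm{HS}}$. *)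

(* Defs.v *)
From mathcomp Require Export all_boot all_order all_algebra.
From mathcomp Require Export sesquilinear finmap.
From mathcomp Require Export all_classical all_reals all_analysis.
From mathcomp Require Export summability.

Set Implicit Arguments.
Unset Strict Implicit.
Unset Printing Implicit Defensive.

Import Order.TTheory GRing.Theory Num.Theory.
Import numFieldNormedType.Exports.

Local Open Scope classical_set_scope.
Local Open Scope ring_scope.

Definition separable (T : topologicalType) : Prop :=
  exists2 S : set T, countable S & dense S.

(* With [H] complete, this says that [H] is a Hilbert space for [dot]. *)
Definition dot_norm_compatible (R : realType) (H : completeNormedModType R)
    (dot : {dot H for idfun}) : Prop :=
  forall x : H, `|x| ^+ 2 = dot x x.

Section Operators.
Variables (R : realType) (H : completeNormedModType R).
Variable dot : {dot H for idfun}.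

Definition compact_operator (A : H -> H) : Prop :=
  compact (closure (A @` [set x | `|x| <= 1])).

Definition self_adjoint (A : H -> H) : Prop :=
  forall x y, dot (A x) y = dot x (A y).

Definition eigenvalues_ge0 (A : H -> H) : Prop :=
  forall (a : R) (x : H), x != 0 -> A x = a *: x -> 0 <= a.

Definition tensor (u v : H) : H -> H := fun w => dot v w *: u.

(* The supremum is the operator norm only for bounded [A]; an unbounded [A]
   gets the value 0. *)
Definition opnorm (A : H -> H) : R :=
  sup [set `|A x| | x in [set x | `|x| <= 1]].

End Operators.

(* Unconditional summation in the norm over an arbitrary set of indices: the
   limit of the finite partial sums along the filter [totally] of large finite
   sets. The notation [f \_ I] is not used because it extends [f] by [point],
   which need not be 0 in an abstract normed module. *)
Definition has_sum_on (R : realType) (V : normedModType R) (T : choiceType)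
    (I : set T) (f : T -> V) (s : V) : Prop :=
  partial_sum (patch (fun=> 0) I f) @ totally --> s.

Definition sum_on (R : realType) (V : normedModType R) (T : choiceType)
    (I : set T) (f : T -> V) : V :=
  summability.sum (patch (fun=> 0) I f).

(* [inl k] is the k-th term, counted from 0, of the non-increasing sequence of
   eigenvalues; [inr j] is the j-th vector adjoined to complete the kernel. *)
Definition eigindex : Type := (nat + nat)%type.

(* Only the indices in [active] carry meaning: the ordered sequence may be
   finite, and there may be any countable number of adjoined vectors. *)
Record eigensystem (R : realType) (H : completeNormedModType R) := Eigensystem {
  active : set eigindex;
  eigval : eigindex -> R;
  eigvec : eigindex -> H
}.

Section Eigensystem.
Variables (R : realType) (H : completeNormedModType R).
Variable dot : {dot H for idfun}.

Record is_eigensystem (A : H -> H) (sp : eigensystem H) : Prop := {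
  active_initial : forall k l : nat, (k <= l)%N ->
    active sp (inl l) -> active sp (inl k);
  eigval_nonincr : forall k l : nat, (k <= l)%N ->
    active sp (inl l) -> eigval sp (inl l) <= eigval sp (inl k);
  eigval_ge0 : forall i, active sp i -> 0 <= eigval sp i;
  eigval_adjoined : forall j : nat, active sp (inr j) -> eigval sp (inr j) = 0;
  eigvec_orthonormal : forall i j, active sp i -> active sp j ->
    dot (eigvec sp i) (eigvec sp j) = (i == j)%:R;
  eigvec_eigen : forall i, active sp i ->
    A (eigvec sp i) = eigval sp i *: eigvec sp i;
  eigvec_complete : forall x : H,
    has_sum_on (active sp) (fun i => tensor dot (eigvec sp i) (eigvec sp i) x) x;
  spectral_expansion : forall x : H,
    has_sum_on (active sp)
      (fun i => eigval sp i *: tensor dot (eigvec sp i) (eigvec sp i) x) (A x)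
}.

Variables (sp : eigensystem H) (J : {fset nat}).

Definition spectral_proj (i : eigindex) : H -> H :=
  tensor dot (eigvec sp i) (eigvec sp i).

Definition outside : set eigindex := active sp `\` [set inl k | k in [set` J]].

(* The infimum is a minimum: the eigenvalues accumulate at most at 0. *)
Definition gap : R :=
  inf [set `|eigval sp (inl k) - eigval sp l| | k in [set` J] & l in outside].

Definition distJ (i : eigindex) : R :=
  inf [set `|eigval sp i - eigval sp (inl m)| | m in [set` J]].

Definition ndistinct : nat := #|` [fset eigval sp (inl k) | k in J]%fset |.

Definition projJ (x : H) : H := \sum_(k <- J) spectral_proj (inl k) x.

Definition sqrtR (x : H) : H :=
  sum_on outside (fun i => (Num.sqrt (distJ i))^-1 *: spectral_proj i x).

Definition sqrtT (x : H) : H := (Num.sqrt gap)^-1 *: projJ x + sqrtR x.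

(* The Hilbert-Schmidt norm, evaluated in the orthonormal basis [eigvec sp] (its
   value is the same in every orthonormal basis). *)
Definition hsnorm (B : H -> H) : R :=
  Num.sqrt (fine (\esum_(i in active sp) (`|B (eigvec sp i)| ^+ 2)%:E)).

Definition alpha (E : H -> H) : R := opnorm (sqrtT \o E \o sqrtT).

Definition beta (E : H -> H) : R :=
  (Num.sqrt gap)^-1 * hsnorm (sqrtR \o E \o projJ).

(* The eigenvector [inl l] corrected to first order in the perturbation [E]. *)
Definition first_order (E : H -> H) (l : nat) : H :=
  eigvec sp (inl l) + sum_on outside (fun m =>
    (dot (E (eigvec sp (inl l))) (eigvec sp m)
       / (eigval sp (inl l) - eigval sp m)) *: eigvec sp m).

End Eigensystem.

(* Main.v *)
Require Import Defs.
From mathcomp Require Import ring lra.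

Set Implicit Arguments.
Unset Strict Implicit.
Unset Printing Implicit Defensive.

Import Order.TTheory GRing.Theory Num.Theory.
Import numFieldNormedType.Exports.

Local Open Scope classical_set_scope.
Local Open Scope ring_scope.

(**
Write [P] for the spectral projection of [J], [S] for [sqrtR] (the weights
[d_m ^ (-1/2)] outside [J], where [d = distJ]), [V] for the inverse weights
[d_m ^ (1/2)] outside [J], so that [x = P x + S (V x)], and let [g] be the gap,
[a = alpha], [b = beta], [E = Ahat - A], [x_k] the [k]-th perturbed eigenvector.

Eigenvalues. By definition of [a], the form of [E] is bounded by [a] times that
of the weight [g P + V^2]. Adding or subtracting [a] times this weight moves the
eigenvalues with index in [J] by [a g], and moves no other eigenvalue across
those, because [d_m] is at most the distance of the [m]-th eigenvalue to each
eigenvalue of [J]. The min-max argument then gives [eigenvalue_shift]: the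
[k]-th perturbed eigenvalue is within [a g <= g / 4] of the unperturbed one.
Consequently it stays at distance at least [3/4 d_m] from the [m]-th
eigenvalue, for [m] outside [J] ([perturbed_gap]).

Leakage out of [J]. In coordinates the eigenvalue equation reads
[(lamhat_k - lam_m) <e_m, x_k> = <e_m, E x_k>]. Outside [J] it bounds [V x_k] by
[4/3 |S E x_k|]. Here [S E x_k] is [S E P x_k] plus [S E S] applied to [V x_k],
and [S E S] has norm at most [a <= 1/4]; absorbing the last term gives
[|V x_k| <= 2 |S E P x_k|] ([sqrtW_psih_le]). Summed over [k], the right-hand
side is controlled by the Hilbert-Schmidt norm in [b].

The residual. Let [G_l] be the first-order correction of [e_l]. The residual
[r_k] has no component in [J], and outside [J] the eigenvalue equation turns
into [(lamhat_k - lam_m) <e_m, r_k> = <e_m, y_k>] with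
[y_k = E S V x_k - sum_l <e_l, E x_k> G_l] ([residual_out]). Splitting [E x_k]
into [E P x_k] and [E S V x_k] in the sum leaves three terms, each of second
order. The two that contain [V x_k] are bounded for each [k] separately; in one
of them the corrections [G_l] have to be applied as an operator, whose norm is
estimated after grouping the indices by distinct eigenvalue, at the price of a
factor [sqrt D] ([norm_sum_correction_le]). The term with [E P x_k] is bounded
directly in the Hilbert-Schmidt norm ([sum_correction_PEP_le]).
*)

(** * Real inner products *)

Section InnerProduct.
Variables (R : realType) (H : completeNormedModType R).
Variable dot : {dot H for idfun}.
Hypothesis hdot : dot_norm_compatible dot.

Lemma dotC x y : dot x y = dot y x.
Proof. by rewrite hermC expr0 mul1r. Qed.

Lemma dotDl x y z : dot (x + y) z = dot x z + dot y z.
Proof. exact: linearDl. Qed.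

Lemma dotBl x y z : dot (x - y) z = dot x z - dot y z.
Proof. exact: linearBl. Qed.

Lemma dotZl a x y : dot (a *: x) y = a * dot x y.
Proof. exact: linearZl_LR. Qed.

Lemma dot0l x : dot 0 x = 0.
Proof. exact: linear0l. Qed.

Lemma dot_suml (I : Type) (r : seq I) (P : pred I) (f : I -> H) y :
  dot (\sum_(i <- r | P i) f i) y = \sum_(i <- r | P i) dot (f i) y.
Proof. exact: linear_sumlz. Qed.

Lemma dotDr x y z : dot x (y + z) = dot x y + dot x z.
Proof. by rewrite dotC dotDl !(dotC x). Qed.

Lemma dotBr x y z : dot x (y - z) = dot x y - dot x z.
Proof. by rewrite dotC dotBl !(dotC x). Qed.

Lemma dotZr a x y : dot x (a *: y) = a * dot x y.
Proof. by rewrite dotC dotZl dotC. Qed.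

Lemma dot0r x : dot x 0 = 0.
Proof. by rewrite dotC dot0l. Qed.

Lemma dot_sumr (I : Type) (r : seq I) (P : pred I) (f : I -> H) y :
  dot y (\sum_(i <- r | P i) f i) = \sum_(i <- r | P i) dot y (f i).
Proof. by rewrite dotC dot_suml; apply: eq_bigr => i _; rewrite dotC. Qed.

Lemma dot_ge0 x : 0 <= dot x x.
Proof. by rewrite -hdot sqr_ge0. Qed.

Lemma cauchy_schwarz x y : `|dot x y| <= `|x| * `|y|.
Proof.
have [->|y0] := eqVneq y 0; first by rewrite dot0r normr0 normr0 mulr0.
have yy0 : 0 < dot y y by rewrite -hdot exprn_gt0// normr_gt0.
rewrite -ler_sqr ?nnegrE ?mulr_ge0// real_normK ?num_real// exprMn !hdot.
have := dot_ge0 (x - (dot x y / dot y y) *: y).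
rewrite !(dotBl, dotBr, dotZl, dotZr) (dotC y x).
have -> : dot x x - dot x y / dot y y * dot x y
   - (dot x y / dot y y * dot x y -
      dot x y / dot y y * (dot x y / dot y y * dot y y))
   = dot x x - dot x y ^+ 2 / dot y y.
  by field; rewrite gt_eqF.
by rewrite subr_ge0 ler_pdivrMr.
Qed.

Lemma cvg_dotr (T : Type) (F : set_system T) {FF : Filter F} (y : H)
    (f : T -> H) s :
  f @ F --> s -> (fun t => dot y (f t)) @ F --> dot y s.
Proof.
move=> fs; apply/cvgrPdist_le => eps eps0.
have d0 : 0 < eps / (`|y| + 1) by rewrite divr_gt0// ltr_wpDl.
move/cvgrPdist_le: fs => /(_ _ d0); apply: filterS => t.
rewrite -dotBr => ht; apply: le_trans (cauchy_schwarz _ _) _.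
apply: (@le_trans _ _ ((`|y| + 1) * `|s - f t|)).
  by rewrite ler_wpM2r// lerDl.
by rewrite mulrC -ler_pdivlMr// ltr_wpDl.
Qed.

End InnerProduct.

(** * Expansions in an orthonormal basis *)

#[local] Existing Instance totally_filter.

Section OrthonormalBasis.
Variables (R : realType) (H : completeNormedModType R).
Variable dot : {dot H for idfun}.
Hypothesis hdot : dot_norm_compatible dot.
Variables (T : choiceType) (I : set T) (e : T -> H).

Definition orthonormal_basis : Prop :=
  (forall i j, I i -> I j -> dot (e i) (e j) = (i == j)%:R) /\
  (forall x, has_sum_on I (fun i => tensor dot (e i) (e i) x) x).

Hypothesis eP : orthonormal_basis.

Lemma partial_sumE (V : zmodType) (f : T -> V) (F : {fset T}) :
  partial_sum f F = \sum_(i <- F) f i.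
Proof. by rewrite /partial_sum big_seq_fsetE. Qed.

Lemma near_totally (F0 : {fset T}) :
  \forall F \near totally, (F0 `<=` F)%fset.
Proof. by exists F0. Qed.

Lemma dot_partial_sum (a : T -> R) (F : {fset T}) j : I j ->
    (forall i, ~ I i -> a i = 0) ->
  dot (e j) (partial_sum (fun i => a i *: e i) F) = (j \in F)%:R * a j.
Proof.
move=> Ij a0; rewrite partial_sumE dot_sumr.
transitivity (\sum_(i <- F) (if i == j then a j else 0)).
  apply: eq_bigr => i _; rewrite dotZr.
  have [Ii|nIi] := pselect (I i); last first.
    rewrite a0// mul0r; case: eqP => // ij; by move: nIi; rewrite ij.
  by rewrite eP.1// eq_sym; case: eqP => [->|_]; rewrite ?mulr1 ?mulr0.
have [jF|jF] := boolP (j \in F).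
  rewrite (big_fsetD1 j)//= eqxx big1_fset ?addr0 ?mul1r// => i.
  by rewrite !inE => /andP[/negbTE ->].
rewrite mul0r big_seq big1// => i iF; case: eqP => // ij.
by move: jF; rewrite -ij iF.
Qed.

(** Once a finite set contains [j], the [j]-th coordinate of the partial sum
    is constant. *)
Lemma coord_sum (a : T -> R) s j : I j ->
    (forall i, ~ I i -> a i = 0) ->
    partial_sum (fun i => a i *: e i) @ totally --> s ->
  dot (e j) s = a j.
Proof.
move=> Ij a0 ps; have h := cvg_dotr hdot (y := e j) ps.
have {}h : (fun F : {fset T} => (j \in F)%:R * a j) @ totally --> dot (e j) s.
  move: h; under eq_fun do rewrite dot_partial_sum//.
  exact.
have a_lim : (fun F : {fset T} => (j \in F)%:R * a j) @ totally --> a j.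
  apply: cvg_near_cst; apply: filterS (near_totally [fset j]%fset) => F.
  by rewrite fsub1set => ->; rewrite mul1r.
exact: cvg_unique h a_lim.
Qed.

(** Extended by 0 off [I], so that sums over arbitrary finite sets of indices
    make sense. *)
Definition coord x i : R := patch (fun=> 0) I (fun i => dot (e i) x) i.

Lemma coordE x i : I i -> coord x i = dot (e i) x.
Proof. by move=> Ii; rewrite /coord patchT// inE. Qed.

Lemma coord_out x i : ~ I i -> coord x i = 0.
Proof. by move=> Ii; rewrite /coord patchC ?inE. Qed.

Lemma patch_scale (J : set T) (a : T -> R) (v : T -> H) :
  patch (fun=> 0) J (fun i => a i *: v i) =
  (fun i => patch (fun=> 0) J a i *: v i).
Proof. by apply/funext => i; rewrite /patch; case: ifP; rewrite ?scale0r. Qed.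

Lemma cvg_coord x : partial_sum (fun i => coord x i *: e i) @ totally --> x.
Proof. by have := eP.2 x; rewrite /has_sum_on /tensor patch_scale. Qed.

Lemma parseval x y :
  (fun F : {fset T} => \sum_(i <- F) coord x i * coord y i) @ totally
    --> dot x y.
Proof.
rewrite dotC; have := @cvg_dotr _ _ _ hdot _ totally _ y _ _ (@cvg_coord x).
suff -> : (fun F => dot y (partial_sum (fun i => coord x i *: e i) F)) =
  (fun F => \sum_(i <- F) coord x i * coord y i); first exact.
apply/funext => F.
rewrite partial_sumE dot_sumr; apply: eq_bigr => i _; rewrite dotZr.
have [Ii|Ii] := pselect (I i); last by rewrite !coord_out// !mul0r.
by rewrite (dotC dot y) (coordE y).
Qed.

Lemma coord_ext x y : (forall i, I i -> dot (e i) x = dot (e i) y) -> x = y.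
Proof.
move=> xy; apply: (cvg_unique _ (@cvg_coord x)) => //.
have -> : coord x = coord y; last exact: cvg_coord.
apply/funext => i; have [Ii|Ii] := pselect (I i); last by rewrite !coord_out.
by rewrite !coordE ?xy.
Qed.

Lemma dot_ge0_coord x y :
  (forall i, I i -> 0 <= dot (e i) x * dot (e i) y) -> 0 <= dot x y.
Proof.
move=> xy; apply: (cvgr_to_ge (@parseval x y)).
apply: nearW => F; apply: sumr_ge0 => i _.
have [Ii|Ii] := pselect (I i); last by rewrite !coord_out// mul0r.
by rewrite !coordE ?xy.
Qed.

Lemma dot_eq_coord x y x' y' :
    (forall i, I i ->
      dot (e i) x * dot (e i) y = dot (e i) x' * dot (e i) y') ->
  dot x y = dot x' y'.
Proof.
move=> xy; apply: (cvg_unique _ (@parseval x y)) => //.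
suff -> : (fun F : {fset T} => \sum_(i <- F) coord x i * coord y i) =
  (fun F : {fset T} => \sum_(i <- F) coord x' i * coord y' i).
  exact: parseval.
apply/funext => F; apply: eq_bigr => i _.
have [Ii|Ii] := pselect (I i); last by rewrite !coord_out// !mul0r.
by rewrite !coordE ?xy.
Qed.

(** By Parseval, to bound a finite sum of squared norms it is enough to bound
    it on finitely many coordinates at a time. *)
Lemma sum_norm_le_coord (K : Type) (r : seq K) (h : K -> H) C :
    (forall F : {fset T}, \sum_(i <- F)
        \sum_(k <- r) coord (h k) i ^+ 2 <= C) ->
  \sum_(k <- r) `|h k| ^+ 2 <= C.
Proof.
move=> hC.
have lim_sum : (fun F : {fset T} =>
    \sum_(k <- r) \sum_(i <- F) coord (h k) i * coord (h k) i) @ totally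
    --> \sum_(k <- r) `|h k| ^+ 2.
  elim: r {hC} => [|k r IH].
    by rewrite big_nil; under eq_fun do rewrite big_nil; exact: cvg_cst.
  rewrite big_cons; under eq_fun do rewrite big_cons.
  by apply: cvgD IH; rewrite hdot; exact: parseval.
apply: (cvgr_to_le lim_sum); apply: nearW => F.
by apply: le_trans (hC F); rewrite exchange_big.
Qed.

(** This turns the norm estimates below into estimates of single
    coordinates. *)
Lemma norm_le_coord x y (C : R) : 0 <= C ->
    (forall i, I i -> `|dot (e i) x| <= C * `|dot (e i) y|) ->
  `|x| <= C * `|y|.
Proof.
move=> C0 xy; rewrite -ler_sqr ?nnegrE ?mulr_ge0// exprMn !hdot.
rewrite -subr_ge0.
apply: (cvgr_to_ge (cvgB (cvgM (cvg_cst (C ^+ 2)) (@parseval y y))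
  (@parseval x x))).
apply: nearW => F; rewrite subr_ge0 /= mulr_sumr; apply: ler_sum => i _.
have [Ii|Ii] := pselect (I i); last by rewrite !coord_out// !mul0r mulr0.
rewrite !coordE// -!expr2 -exprMn -[X in X <= _]real_normK ?num_real//.
rewrite -[X in _ <= X]real_normK ?num_real// ler_sqr ?nnegrE//.
by rewrite normrM (ger0_norm C0) xy.
Qed.

(** The family is summable because its partial sums differ by at most [C]
    times the differences of the partial sums of the expansion of [x], which
    is summable; the coordinates of the sum are then those of the family. *)
Lemma sum_on_coord (J : set T) (a : T -> R) (C : R) x j : J `<=` I -> 0 <= C ->
    (forall i, J i -> `|a i| <= C * `|dot (e i) x|) -> I j ->
  dot (e j) (sum_on J (fun i => a i *: e i)) = patch (fun=> 0) J a j.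
Proof.
move=> JI C0 aC Ij; rewrite /sum_on patch_scale; set b := patch _ _ _.
have b0 i : ~ I i -> b i = 0 by move=> Ii; rewrite /b patchC ?inE// => /JI.
have bC i : I i -> `|b i| <= C * `|dot (e i) x|.
  move=> Ii; rewrite /b /patch; case: ifP => [/set_mem/aC//|_].
  by rewrite normr0 mulr_ge0.
apply: coord_sum => //.
have s1 F i : I i -> dot (e i) (partial_sum (fun i => b i *: e i) F) =
  (i \in F)%:R * b i by move=> Ii; rewrite dot_partial_sum.
have s2 F i : I i -> dot (e i) (partial_sum (fun i => coord x i *: e i) F) =
  (i \in F)%:R * dot (e i) x.
  by move=> Ii; rewrite dot_partial_sum ?coordE//; exact: coord_out.
apply/cauchy_cvgP; apply: cauchy_exP => eps eps0.
have d0 : 0 < eps / (C + 1) / 2 by rewrite !divr_gt0// ltr_wpDl.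
have /cvgrPdist_lt/(_ _ d0)[F0 _ hF0] := @cvg_coord x.
exists (partial_sum (fun i => b i *: e i) F0).
exists F0 => // F /= F0F; rewrite -ball_normE/=.
set t := partial_sum _; set s := partial_sum _ in hF0.
apply: (@le_lt_trans _ _ (C * `|s F0 - s F|)).
  apply: norm_le_coord => // i Ii; rewrite !dotBr !s1// !s2//.
  by rewrite -!mulrBl !normrM mulrCA ler_wpM2l// bC.
have : `|s F0 - s F| < eps / (C + 1).
  rewrite (splitr (eps / _)); have -> : s F0 - s F = (x - s F) - (x - s F0).
    by rewrite opprB [RHS]addrC addrA subrK.
  by apply: le_lt_trans (ler_normB _ _) _; apply: ltrD; apply: hF0 => /=.
rewrite ltr_pdivlMr ?ltr_wpDl//; apply: le_lt_trans.
by rewrite mulrC ler_wpM2l// lerDl.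
Qed.

Definition multiplier (c : T -> R) (x : H) : H :=
  sum_on I (fun i => (c i * dot (e i) x) *: e i).

Lemma multiplier_coord (c : T -> R) (C : R) x j :
  (forall i, I i -> `|c i| <= C) -> I j ->
  dot (e j) (multiplier c x) = c j * dot (e j) x.
Proof.
move=> cC Ij; have C0 : 0 <= C by rewrite (le_trans _ (cC _ Ij)).
rewrite (sum_on_coord (x := x) (C := C)) ?patchT ?inE// => i Ii.
by rewrite normrM ler_wpM2r// cC.
Qed.

End OrthonormalBasis.

(** * Finite orthonormal families *)

Section FiniteOrthonormal.
Variables (R : realType) (H : completeNormedModType R).
Variable dot : {dot H for idfun}.
Hypothesis hdot : dot_norm_compatible dot.

Lemma norm_le_dual (z : H) (M : R) : 0 <= M ->
  (forall y, dot z y <= M * `|y|) -> `|z| <= M.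
Proof.
move=> M0 /(_ z); rewrite -hdot expr2.
have [->|z0] := eqVneq z 0; first by rewrite normr0.
by rewrite ler_pM2r// normr_gt0.
Qed.

Section Family.
Variables (K : eqType) (r : seq K) (u : K -> H).
Hypothesis uniq_r : uniq r.
Hypothesis u_on : {in r &, forall k l, dot (u k) (u l) = (k == l)%:R}.

Lemma dot_lincomb (a : K -> R) : {in r, forall k,
  dot (u k) (\sum_(l <- r) a l *: u l) = a k}.
Proof.
move=> k kr; rewrite dot_sumr (bigD1_seq k)//= dotZr u_on// eqxx mulr1.
rewrite big_seq_cond big1 ?addr0// => l /andP[lr lk].
by rewrite dotZr u_on// eq_sym (negbTE lk) mulr0.
Qed.

Lemma norm_lincomb (a : K -> R) :
  `|\sum_(l <- r) a l *: u l| ^+ 2 = \sum_(l <- r) a l ^+ 2.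
Proof.
rewrite hdot dot_suml; apply: eq_big_seq => l lr.
by rewrite dotZl dot_lincomb.
Qed.

Lemma bessel (v : H) : \sum_(k <- r) dot (u k) v ^+ 2 <= `|v| ^+ 2.
Proof.
set s := \sum_(k <- r) dot (u k) v *: u k.
have sv : dot v s = \sum_(k <- r) dot (u k) v ^+ 2.
  by rewrite dot_sumr; apply: eq_bigr => k _; rewrite dotZr (dotC dot v).
have ss : dot s s = \sum_(k <- r) dot (u k) v ^+ 2.
  by rewrite -hdot norm_lincomb.
have := dot_ge0 hdot (v - s).
by rewrite !(dotBl, dotBr) (dotC dot s v) sv ss subrr subr0 subr_ge0 hdot.
Qed.

End Family.

Lemma sum_sqr_coord_le (T : choiceType) (I : set T) (e : T -> H) v
    (F : {fset T}) : orthonormal_basis dot I e ->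
  \sum_(i <- F) coord dot I e v i ^+ 2 <= `|v| ^+ 2.
Proof.
move=> eP; rewrite (bigID (fun i => i \in I))/= [X in _ + X]big1 ?addr0;
  last first.
  by move=> i Ii; rewrite coord_out ?expr0n// => /mem_set; rewrite (negbTE Ii).
rewrite -big_filter; set r := [seq _ <- _ | _].
rewrite (eq_big_seq (fun i => dot (e i) v ^+ 2)); last first.
  by move=> i; rewrite mem_filter => /andP[/set_mem Ii _]; rewrite coordE.
apply: bessel; first by rewrite filter_uniq ?fset_uniq.
move=> i j; rewrite !mem_filter => /andP[/set_mem Ii _] /andP[/set_mem Ij _].
exact: eP.1.
Qed.

(** The ideal property of the Hilbert-Schmidt norm: if [v_l] is orthonormal
    and [w_l = M v_l] with [M] of norm at most [C], the vectors on the left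
    are the images of the [u_k] under the operator that maps [x] to [sum_l <x,
    w_l> g_l]. Each coordinate of that image is the inner product of [x] with
    a combination of the [w_l], so that Bessel's inequality applies coordinate
    by coordinate. *)
Lemma hs_contraction (T : choiceType) (I : set T) (e : T -> H)
    (K L : eqType) (r : seq K) (q : seq L) (u : K -> H) (w g : L -> H) (C : R) :
    orthonormal_basis dot I e -> uniq r ->
    {in r &, forall k l, dot (u k) (u l) = (k == l)%:R} ->
    (forall a : L -> R, `|\sum_(l <- q) a l *: w l| ^+ 2 <=
       C ^+ 2 * \sum_(l <- q) a l ^+ 2) ->
  \sum_(k <- r) `|\sum_(l <- q) dot (u k) (w l) *: g l| ^+ 2 <=
    C ^+ 2 * \sum_(l <- q) `|g l| ^+ 2.
Proof.
move=> eP ur u_on wC; apply: (sum_norm_le_coord hdot eP) => F.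
have coord_lin i k : coord dot I e (\sum_(l <- q) dot (u k) (w l) *: g l) i =
    dot (u k) (\sum_(l <- q) coord dot I e (g l) i *: w l).
  have [Ii|Ii] := pselect (I i); last first.
    rewrite coord_out// big1 ?dot0r// => l _.
    by rewrite coord_out// scale0r.
  rewrite coordE// !dot_sumr; apply: eq_bigr => l _.
  by rewrite !dotZr coordE// mulrC.
apply: (@le_trans _ _ (\sum_(i <- F) C ^+ 2 *
    \sum_(l <- q) coord dot I e (g l) i ^+ 2)).
  apply: ler_sum => i _; apply: le_trans (wC _).
  rewrite (eq_bigr _ (fun k _ => congr1 (fun x => x ^+ 2) (coord_lin i k))).
  exact: bessel.
rewrite -mulr_sumr ler_wpM2l ?sqr_ge0// exchange_big/=.
by apply: ler_sum => l _; exact: sum_sqr_coord_le.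
Qed.

(** [n] linear equations in [n + 1] unknowns have a nonzero solution: this is
    the dimension count behind the min-max principle. *)
Lemma exists_orthogonal_combination n (u v : nat -> H) :
  exists2 a : nat -> R, \sum_(i < n.+1) a i ^+ 2 != 0 &
    forall j, (j < n)%N -> dot (\sum_(i < n.+1) a i *: u i) (v j) = 0.
Proof.
pose M : 'M[R]_(n.+1, n) := \matrix_(i, j) dot (u i) (v j).
have : kermx M != 0.
  by rewrite kermx_eq0 -row_leq_rank -ltnNge ltnS rank_leq_col.
case/rowV0Pn => b /sub_kermxP bM b0.
have bE (i : 'I_n.+1) : b 0 (inord i) = b 0 i by rewrite inord_val.
exists (fun i => b 0 (inord i)).
  apply: contraNneq b0 => /eqP; rewrite psumr_eq0; last by move=> i _;
    exact: sqr_ge0.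
  move=> /allP b0; apply/eqP/rowP => i; rewrite mxE -bE.
  by have := b0 i (mem_index_enum _); rewrite sqrf_eq0 => /eqP.
move=> j jn; have := congr1 (fun X : 'rV__ => X 0 (Ordinal jn)) bM.
rewrite !mxE => <-; rewrite dot_suml; apply: eq_bigr => i _.
by rewrite dotZl mxE bE.
Qed.

End FiniteOrthonormal.

Lemma sqr_sum_le (R : realType) (K : Type) (r : seq K) (t : K -> R) :
  (\sum_(i <- r) t i) ^+ 2 <= (size r)%:R * \sum_(i <- r) t i ^+ 2.
Proof.
elim: r => [|k r IH]; first by rewrite !big_nil expr0n mulr0.
rewrite !big_cons /=; set S := \sum_(i <- r) t i in IH *.
set Q := \sum_(i <- r) t i ^+ 2 in IH *; rewrite -natr1.
have : 0 <= \sum_(i <- r) (t k - t i) ^+ 2.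
  by apply: sumr_ge0 => i _; exact: sqr_ge0.
suff -> : \sum_(i <- r) (t k - t i) ^+ 2 =
  (size r)%:R * t k ^+ 2 - 2 * t k * S + Q by nra.
rewrite /S /Q; elim: r {IH S Q} => [|i r IH].
  by rewrite !big_nil/=; ring.
by rewrite !big_cons IH/= -natr1; ring.
Qed.

(** * Compact operators are bounded *)

Lemma compact_operator_bounded (R : realType) (H : completeNormedModType R)
    (A : {linear H -> H}) : compact_operator A ->
  exists2 C : R, 0 <= C & forall x, `|A x| <= C * `|x|.
Proof.
move=> /compact_bounded[M [_ hM]].
exists (`|M| + 1); first by rewrite addr_ge0.
have {}hM y : `|y| <= 1 -> `|A y| <= `|M| + 1.
  move=> y1; apply: (hM (`|M| + 1)); last first.
    by apply: subset_closure; exists y.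
  by rewrite (le_lt_trans (ler_norm _))// ltrDl.
move=> x; have [->|x0] := eqVneq x 0; first by rewrite linear0 !normr0 mulr0.
have nx : 0 < `|x| by rewrite normr_gt0.
have := hM (`|x|^-1 *: x).
rewrite linearZ/= !normrZ normfV normr_id mulVf ?gt_eqF// => /(_ (lexx _)).
by rewrite mulrC ler_pdivrMr.
Qed.

(** * The spectral projection and the weights *)

Section Setting.
Variables (R : realType) (H : completeNormedModType R).
Variable dot : {dot H for idfun}.
Hypothesis hdot : dot_norm_compatible dot.
Variables (A : H -> H) (sp : eigensystem H).
Hypothesis hsp : is_eigensystem dot A sp.
Variable J : {fset nat}.
Hypothesis hJ0 : J != fset0.
Hypothesis hJ : forall k, k \in J -> active sp (inl k).
Hypothesis hgap : 0 < gap sp J.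

Local Notation I := (active sp).
Local Notation e := (eigvec sp).
Local Notation ev := (eigval sp).
Local Notation O := (outside sp J).
Local Notation d := (distJ sp J).
Local Notation g := (gap sp J).
Local Notation P := (projJ dot sp J).
Local Notation S := (sqrtR dot sp J).

Lemma eigen_basis : orthonormal_basis dot I e.
Proof.
by split; [exact: eigvec_orthonormal hsp|exact: eigvec_complete hsp].
Qed.
Let eP := eigen_basis.

Lemma outside_active i : O i -> I i.
Proof. by case. Qed.

Lemma outside_notin k : k \in J -> ~ O (inl k).
Proof. by move=> kJ [_]; apply; exists k. Qed.

(** Every proof by coordinates splits the basis into the part with index in
    [J] and the part outside. *)
Lemma active_ind (Pr : eigindex -> Prop) :
  (forall k, k \in J -> Pr (inl k)) -> (forall m, O m -> Pr m) ->
  forall i, I i -> Pr i.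
Proof.
move=> hl ho i Ii;
  have [[k kJ <-]|nJ] := pselect ([set inl k | k in [set` J]] i).
  exact: hl.
exact: ho.
Qed.

Lemma gap_le k m : k \in J -> O m -> g <= `|ev (inl k) - ev m|.
Proof.
move=> kJ Om; apply: ge_inf; first by exists 0 => _ [? _ [? _ <-]].
by exists k => //; exists m.
Qed.

Lemma distJ_le i k : k \in J -> d i <= `|ev i - ev (inl k)|.
Proof.
by move=> kJ; apply: ge_inf; [exists 0 => _ [? _ <-]|exists k].
Qed.

Lemma gap_le_distJ m : O m -> g <= d m.
Proof.
move=> Om; apply: lb_le_inf.
  by case/fset0Pn: hJ0 => k kJ; exists `|ev m - ev (inl k)|, k.
by move=> _ [k kJ <-]; rewrite distrC gap_le.
Qed.

Lemma distJ_gt0 m : O m -> 0 < d m.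
Proof. by move=> /gap_le_distJ; exact: lt_le_trans. Qed.

Lemma eigval_le_first i : I i -> ev i <= ev (inl 0%N).
Proof.
case/fset0Pn: hJ0 => k /hJ Ik; have I0 := active_initial hsp (leq0n k) Ik.
case: i => [i Ii|j Ij]; first exact: eigval_nonincr hsp _ _ (leq0n i) Ii.
by rewrite (eigval_adjoined hsp Ij) (eigval_ge0 hsp I0).
Qed.

Lemma distJ_le_first m : O m -> d m <= ev (inl 0%N).
Proof.
case/fset0Pn: hJ0 => k kJ Om.
apply: le_trans (distJ_le m kJ) _; rewrite ler_norml.
have := eigval_le_first (outside_active Om); have := eigval_le_first (hJ kJ).
have := eigval_ge0 hsp (outside_active Om); have := eigval_ge0 hsp (hJ kJ).
by move=> *; apply/andP; split; lra.
Qed.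

Lemma inl_on_J :
  {in J &, forall k l, dot (e (inl k)) (e (inl l)) = (k == l)%:R}.
Proof.
by move=> k l kJ lJ; rewrite (eigvec_orthonormal hsp (hJ kJ) (hJ lJ)).
Qed.

Lemma projJE x : P x = \sum_(k <- J) dot (e (inl k)) x *: e (inl k).
Proof. by []. Qed.

Lemma projJ_in x k : k \in J -> dot (e (inl k)) (P x) = dot (e (inl k)) x.
Proof.
by move=> kJ; rewrite projJE (dot_lincomb (fset_uniq J) inl_on_J).
Qed.

Lemma projJ_out x m : O m -> dot (e m) (P x) = 0.
Proof.
move=> Om; rewrite projJE dot_sumr big_seq big1// => k kJ.
rewrite dotZr (eigvec_orthonormal hsp (outside_active Om) (hJ kJ)).
case: eqP => [mk|]; rewrite ?mulr0//.
by have := outside_notin kJ; rewrite -mk.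
Qed.

Lemma sqrtR_coord x i : I i ->
  dot (e i) (S x) =
    patch (fun=> 0) O (fun m => (Num.sqrt (d m))^-1 * dot (e m) x) i.
Proof.
move=> Ii.
have -> : S x = sum_on O (fun m => ((Num.sqrt (d m))^-1 * dot (e m) x) *: e m).
  by congr sum_on; apply/funext => m; rewrite -scalerA.
apply: (sum_on_coord hdot eP (C := (Num.sqrt g)^-1) (x := x)) => //.
- by move=> m /outside_active.
- move=> m Om; rewrite normrM ler_wpM2r//.
  rewrite ger0_norm ?invr_ge0// lef_pV2 ?posrE ?sqrtr_gt0// ?distJ_gt0//.
  by rewrite ler_wsqrtr// gap_le_distJ.
Qed.

Lemma sqrtR_in x k : k \in J -> dot (e (inl k)) (S x) = 0.
Proof.
move=> kJ; rewrite sqrtR_coord; last exact: hJ.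
by rewrite patchC// inE; exact: outside_notin.
Qed.

Lemma sqrtR_out x m : O m ->
  dot (e m) (S x) = (Num.sqrt (d m))^-1 * dot (e m) x.
Proof.
by move=> Om; rewrite sqrtR_coord ?patchT ?inE//; exact: outside_active.
Qed.

(** The inverse of [sqrtR] on the orthogonal complement of the range of
    [projJ]; it is bounded because the eigenvalues are. *)
Definition sqrtW : H -> H :=
  multiplier dot I e (patch (fun=> 0) O (fun m => Num.sqrt (d m))).

Local Notation V := sqrtW.

Lemma sqrtW_coord x i : I i ->
  dot (e i) (V x) = patch (fun=> 0) O (fun m => Num.sqrt (d m)) i * dot (e i) x.
Proof.
apply: (multiplier_coord hdot eP (C := Num.sqrt (ev (inl 0%N)))) => j Ij.
rewrite /patch; case: ifP => [/set_mem Oj|_]; last by rewrite normr0 sqrtr_ge0.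
by rewrite ger0_norm ?sqrtr_ge0// ler_wsqrtr// distJ_le_first.
Qed.

Lemma sqrtW_in x k : k \in J -> dot (e (inl k)) (V x) = 0.
Proof.
move=> kJ; rewrite sqrtW_coord; last exact: hJ.
by rewrite patchC ?mul0r// inE; exact: outside_notin.
Qed.

Lemma sqrtW_out x m : O m -> dot (e m) (V x) = Num.sqrt (d m) * dot (e m) x.
Proof.
by move=> Om; rewrite sqrtW_coord ?patchT ?inE//; exact: outside_active.
Qed.

Lemma active_ext x y :
  (forall k, k \in J -> dot (e (inl k)) x = dot (e (inl k)) y) ->
  (forall m, O m -> dot (e m) x = dot (e m) y) -> x = y.
Proof. by move=> hin hout; apply: (coord_ext eP); exact: active_ind. Qed.

Lemma projJ_sqrtR_sqrtW x : P x + S (V x) = x.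
Proof.
apply: active_ext => [k kJ|m Om]; rewrite dotDr.
  by rewrite projJ_in// sqrtR_in// addr0.
rewrite projJ_out// sqrtR_out// sqrtW_out// add0r mulKf//.
by rewrite gt_eqF// sqrtr_gt0 distJ_gt0.
Qed.

Lemma projJ_sym x y : dot (P x) y = dot x (P y).
Proof.
apply: (dot_eq_coord hdot eP); apply: active_ind => [k kJ|m Om].
  by rewrite !projJ_in.
by rewrite !projJ_out// mul0r mulr0.
Qed.

Lemma sqrtR_sym x y : dot (S x) y = dot x (S y).
Proof.
apply: (dot_eq_coord hdot eP); apply: active_ind => [k kJ|m Om].
  by rewrite !sqrtR_in// mul0r mulr0.
by rewrite !sqrtR_out//; ring.
Qed.

Lemma sqrtRD x y : S (x + y) = S x + S y.
Proof.
apply: active_ext => [k kJ|m Om]; rewrite dotDr;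
  first by rewrite !sqrtR_in// addr0.
by rewrite !sqrtR_out// dotDr mulrDr.
Qed.

Lemma sqrtRZ a x : S (a *: x) = a *: S x.
Proof.
apply: active_ext => [k kJ|m Om]; rewrite dotZr;
  first by rewrite !sqrtR_in// mulr0.
by rewrite !sqrtR_out// dotZr mulrCA.
Qed.

Lemma sqrtR0 : S 0 = 0.
Proof. by apply: (addrI (S 0)); rewrite -sqrtRD !addr0. Qed.

Lemma projJD x y : P (x + y) = P x + P y.
Proof.
apply: active_ext => [k kJ|m Om]; rewrite dotDr;
  first by rewrite !projJ_in// dotDr.
by rewrite !projJ_out// addr0.
Qed.

Lemma projJZ a x : P (a *: x) = a *: P x.
Proof.
apply: active_ext => [k kJ|m Om]; rewrite dotZr;
  first by rewrite !projJ_in// dotZr.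
by rewrite !projJ_out// mulr0.
Qed.

Lemma projJ_idem x : P (P x) = P x.
Proof.
by apply: active_ext => [k kJ|m Om]; [rewrite !projJ_in|rewrite !projJ_out].
Qed.

Lemma sqrtR_projJ x : S (P x) = 0.
Proof.
apply: active_ext => [k kJ|m Om]; rewrite dot0r; first by rewrite sqrtR_in.
by rewrite sqrtR_out// projJ_out// mulr0.
Qed.

Lemma projJ_sqrtW x : P (V x) = 0.
Proof.
apply: active_ext => [k kJ|m Om]; rewrite dot0r;
  first by rewrite projJ_in// sqrtW_in.
by rewrite projJ_out.
Qed.

Lemma projJ_le x : `|P x| <= `|x|.
Proof.
rewrite -[X in _ <= X]mul1r; apply: (norm_le_coord hdot eP) => //.
apply: active_ind => [k kJ|m Om]; rewrite mul1r; first by rewrite projJ_in.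
by rewrite projJ_out// normr0.
Qed.

Lemma sqrtR_le x : `|S x| <= (Num.sqrt g)^-1 * `|x|.
Proof.
apply: (norm_le_coord hdot eP) => [|i]; first by rewrite invr_ge0 sqrtr_ge0.
move: i; apply: active_ind => [k kJ|m Om].
  by rewrite sqrtR_in// normr0 mulr_ge0// invr_ge0 sqrtr_ge0.
rewrite sqrtR_out// normrM ler_wpM2r// ger0_norm ?invr_ge0 ?sqrtr_ge0//.
by rewrite lef_pV2 ?posrE ?sqrtr_gt0 ?distJ_gt0// ler_wsqrtr// gap_le_distJ.
Qed.

(** * Blocks of the perturbation *)

Variable E : {linear H -> H}.
Variable CE : R.
Hypothesis hCE : forall x, `|E x| <= CE * `|x|.

Local Notation al := (alpha dot sp J E).
Local Notation T := (sqrtT dot sp J).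

Lemma sqrtTD x y : T (x + y) = T x + T y.
Proof. by rewrite /sqrtT projJD sqrtRD scalerDr addrACA. Qed.

Lemma sqrtTZ a x : T (a *: x) = a *: T x.
Proof. by rewrite /sqrtT projJZ sqrtRZ scalerDr !scalerA mulrC. Qed.

Lemma sqrtT_sym x y : dot (T x) y = dot x (T y).
Proof. by rewrite /sqrtT dotDl dotDr dotZl dotZr projJ_sym sqrtR_sym. Qed.

Lemma sqrtT_le x : `|T x| <= 2 * (Num.sqrt g)^-1 * `|x|.
Proof.
rewrite /sqrtT; apply: le_trans (ler_normD _ _) _.
rewrite normrZ ger0_norm ?invr_ge0 ?sqrtr_ge0// mulrDl mul1r mulrDl.
by rewrite lerD ?sqrtR_le// ler_wpM2l ?projJ_le// invr_ge0 sqrtr_ge0.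
Qed.

Lemma sqrtT_projJ x : T (Num.sqrt g *: P x) = P x.
Proof.
rewrite sqrtTZ /sqrtT sqrtR_projJ projJ_idem addr0 scalerA mulfV ?scale1r//.
by rewrite gt_eqF// sqrtr_gt0.
Qed.

Lemma sqrtT_sub x : T (x - P x) = S x.
Proof.
rewrite -scaleN1r sqrtTD sqrtTZ /sqrtT projJ_idem sqrtR_projJ addr0.
by rewrite scaleN1r addrAC subrr add0r.
Qed.

(** [alpha] is a supremum, hence a bound for the norm only because [E] is
    bounded. *)
Lemma alpha_bounds : 0 <= al /\ forall x, `|T (E (T x))| <= al * `|x|.
Proof.
have t0 : 0 <= 2 * (Num.sqrt g)^-1 by rewrite mulr_ge0// invr_ge0 sqrtr_ge0.
have hE x : `|E x| <= `|CE| * `|x|.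
  by apply: le_trans (hCE x) _; rewrite ler_wpM2r// ler_norm.
pose B := 2 * (Num.sqrt g)^-1 * (`|CE| * (2 * (Num.sqrt g)^-1)).
have hB x : `|x| <= 1 -> `|T (E (T x))| <= B.
  move=> x1; apply: le_trans (sqrtT_le _) _; rewrite ler_wpM2l//.
  apply: le_trans (hE _) _; rewrite ler_wpM2l//.
  by apply: le_trans (sqrtT_le _) _; rewrite ler_piMr.
have le_al y : `|y| <= 1 -> `|T (E (T y))| <= al.
  move=> y1; apply: ub_le_sup; first by exists B => _ [x /= x1 <-]; exact: hB.
  by exists y.
have al0 : 0 <= al by apply: le_trans (le_al 0 _); rewrite ?normr0.
split=> // x; have [->|x0] := eqVneq x 0.
  have T0 : T 0 = 0 by rewrite -[X in T X](scale0r (0 : H)) sqrtTZ scale0r.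
  by rewrite T0 linear0 T0 !normr0 mulr0.
have nx : 0 < `|x| by rewrite normr_gt0.
have := le_al (`|x|^-1 *: x).
rewrite sqrtTZ linearZ/= sqrtTZ !normrZ normfV normr_id mulVf ?gt_eqF//.
by move=> /(_ (lexx _)); rewrite mulrC ler_pdivrMr.
Qed.

Lemma alpha_ge0 : 0 <= al. Proof. exact: alpha_bounds.1. Qed.

Lemma dot_sqrtT_le x y : dot (E (T x)) (T y) <= al * `|x| * `|y|.
Proof.
rewrite -sqrtT_sym; apply: le_trans (ler_norm _) _.
apply: le_trans (cauchy_schwarz hdot _ _) _.
by rewrite ler_wpM2r// alpha_bounds.2.
Qed.

Lemma norm_sub_projJ x : `|x - P x| <= `|x|.
Proof.
rewrite -[X in _ <= X]mul1r; apply: (norm_le_coord hdot eP) => //.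
apply: active_ind => [k kJ|m Om]; rewrite mul1r dotBr.
  by rewrite projJ_in// subrr normr0.
by rewrite projJ_out// subr0.
Qed.

Lemma norm_scaled_projJ x : `|Num.sqrt g *: P x| <= Num.sqrt g * `|x|.
Proof.
by rewrite normrZ ger0_norm ?sqrtr_ge0// ler_wpM2l ?sqrtr_ge0// projJ_le.
Qed.

(** [projJ] is [T] restricted to the range of [projJ], up to the factor [sqrt
    g], and [S] is [T] restricted to the complement; each block of [E]
    therefore inherits the bound by [alpha], with a factor [sqrt g] for each
    [projJ]. *)
Lemma norm_PEP x : `|P (E (P x))| <= al * g * `|x|.
Proof.
apply: (norm_le_dual hdot) => [|y]; first by rewrite !mulr_ge0 ?alpha_ge0// ltW.
rewrite projJ_sym -(sqrtT_projJ x) -(sqrtT_projJ y).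
apply: le_trans (dot_sqrtT_le _ _) _.
rewrite -[in X in _ <= X](sqr_sqrtr (ltW hgap)).
rewrite (_ : al * Num.sqrt g ^+ 2 * `|x| * `|y| =
  al * (Num.sqrt g * `|x|) * (Num.sqrt g * `|y|)); last by ring.
by apply: ler_pM; rewrite ?mulr_ge0 ?alpha_ge0 ?norm_scaled_projJ//
   ler_wpM2l ?alpha_ge0 ?norm_scaled_projJ.
Qed.

Lemma norm_PES x : `|P (E (S x))| <= al * Num.sqrt g * `|x|.
Proof.
apply: (norm_le_dual hdot) => [|y].
  by rewrite !mulr_ge0 ?alpha_ge0 ?sqrtr_ge0.
rewrite projJ_sym -(sqrtT_sub x) -(sqrtT_projJ y).
apply: le_trans (dot_sqrtT_le _ _) _.
rewrite (_ : al * Num.sqrt g * `|x| * `|y| =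
  al * `|x| * (Num.sqrt g * `|y|)); last by ring.
by apply: ler_pM; rewrite ?mulr_ge0 ?alpha_ge0 ?norm_scaled_projJ//
   ler_wpM2l ?alpha_ge0 ?norm_sub_projJ.
Qed.

Lemma norm_SEP x : `|S (E (P x))| <= al * Num.sqrt g * `|x|.
Proof.
apply: (norm_le_dual hdot) => [|y].
  by rewrite !mulr_ge0 ?alpha_ge0 ?sqrtr_ge0.
rewrite sqrtR_sym -(sqrtT_sub y) -(sqrtT_projJ x).
apply: le_trans (dot_sqrtT_le _ _) _.
rewrite (_ : al * Num.sqrt g * `|x| * `|y| =
  al * (Num.sqrt g * `|x|) * `|y|); last by ring.
by apply: ler_pM; rewrite ?mulr_ge0 ?alpha_ge0 ?norm_sub_projJ//
   ler_wpM2l ?alpha_ge0 ?norm_scaled_projJ.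
Qed.

Lemma norm_SES x : `|S (E (S x))| <= al * `|x|.
Proof.
apply: (norm_le_dual hdot) => [|y]; first by rewrite !mulr_ge0 ?alpha_ge0.
rewrite sqrtR_sym -(sqrtT_sub x) -(sqrtT_sub y).
apply: le_trans (dot_sqrtT_le _ _) _.
by apply: ler_pM; rewrite ?mulr_ge0 ?alpha_ge0 ?norm_sub_projJ//
   ler_wpM2l ?alpha_ge0 ?norm_sub_projJ.
Qed.

(** Every [x] is [T y] with [y = sqrt g P x + V x], and the weight on the
    right is [|y| ^ 2]. *)
Lemma quadratic_form_le x :
  `|dot (E x) x| <= al * (g * `|P x| ^+ 2 + `|V x| ^+ 2).
Proof.
set y := Num.sqrt g *: P x + V x.
have -> : g * `|P x| ^+ 2 + `|V x| ^+ 2 = `|y| ^+ 2.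
  have PV0 : dot (P x) (V x) = 0 by rewrite projJ_sym projJ_sqrtW dot0r.
  rewrite !hdot /y !(dotDl, dotDr, dotZl, dotZr) (dotC dot (V x) (P x)) PV0.
  by rewrite !mulr0 addr0 add0r mulrA -expr2 sqr_sqrtr// ltW.
have -> : x = T y.
  rewrite /y sqrtTD sqrtT_projJ.
  by rewrite -[in T _](subr0 (V x)) -(projJ_sqrtW x) sqrtT_sub
    projJ_sqrtR_sqrtW.
rewrite -sqrtT_sym; apply: le_trans (cauchy_schwarz hdot _ _) _.
by rewrite expr2 mulrA ler_wpM2r// alpha_bounds.2.
Qed.

End Setting.

(** * Perturbation of the eigenvalues *)

Section Rayleigh.
Variables (R : realType) (H : completeNormedModType R).
Variable dot : {dot H for idfun}.
Hypothesis hdot : dot_norm_compatible dot.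
Variables (A : H -> H) (sp : eigensystem H).
Hypothesis hsp : is_eigensystem dot A sp.
Hypothesis hA : self_adjoint dot A.

Local Notation I := (active sp).
Local Notation e := (eigvec sp).
Local Notation ev := (eigval sp).

Lemma dot_eigvec_op i x : I i -> dot (e i) (A x) = ev i * dot (e i) x.
Proof. by move=> Ii; rewrite -hA (eigvec_eigen hsp Ii) dotZl. Qed.

Lemma rayleigh_ge c x :
  (forall i, I i -> dot (e i) x != 0 -> c <= ev i) ->
  c * `|x| ^+ 2 <= dot (A x) x.
Proof.
move=> hx; rewrite hdot -dotZl -subr_ge0 -dotBl.
apply: (dot_ge0_coord hdot (eigen_basis hsp)) => i Ii.
rewrite dotBr dot_eigvec_op// dotZr -mulrBl -mulrA -expr2.
have [->|/(hx i Ii) ci] := eqVneq (dot (e i) x) 0;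
  first by rewrite expr0n mulr0.
by rewrite mulr_ge0 ?sqr_ge0// subr_ge0.
Qed.

Lemma rayleigh_le c x :
  (forall i, I i -> dot (e i) x != 0 -> ev i <= c) ->
  dot (A x) x <= c * `|x| ^+ 2.
Proof.
move=> hx; rewrite hdot -dotZl -subr_ge0 -dotBl.
apply: (dot_ge0_coord hdot (eigen_basis hsp)) => i Ii.
rewrite dotBr dot_eigvec_op// dotZr -mulrBl -mulrA -expr2.
have [->|/(hx i Ii) ci] := eqVneq (dot (e i) x) 0;
  first by rewrite expr0n mulr0.
by rewrite mulr_ge0 ?sqr_ge0// subr_ge0.
Qed.

Lemma support_lincomb k (a : nat -> R) : I (inl k) ->
  forall i, I i -> dot (e i) (\sum_(j < k.+1) a j *: e (inl (val j))) != 0 ->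
  ev (inl k) <= ev i.
Proof.
move=> Ik i Ii nz.
have [j ij] : exists j : 'I_k.+1, i = inl (val j).
  apply: contrapT => noj; move/eqP: nz; apply.
  rewrite dot_sumr big1// => j _; rewrite dotZr.
  have Ij : I (inl (val j)) by apply: (active_initial hsp _ Ik);
    rewrite -ltnS ltn_ord.
  rewrite (eigvec_orthonormal hsp Ii Ij); case: eqP => [ij|];
    last by rewrite mulr0.
  by case: noj; exists j.
by rewrite ij; apply: (eigval_nonincr hsp _ Ik); rewrite -ltnS ltn_ord.
Qed.

Lemma support_orthogonal k x : I (inl k) ->
  (forall j, (j < k)%N -> dot x (e (inl j)) = 0) ->
  forall i, I i -> dot (e i) x != 0 -> ev i <= ev (inl k).
Proof.
move=> Ik hx [j|j] Ij nz; last first.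
  by rewrite (eigval_adjoined hsp Ij) (eigval_ge0 hsp Ik).
have [jk|kj] := ltnP j k; first by rewrite (dotC dot) hx ?eqxx in nz.
exact: (eigval_nonincr hsp kj Ij).
Qed.

Lemma norm_eigvec_lincomb k (a : nat -> R) : I (inl k) ->
  `|\sum_(j < k.+1) a j *: e (inl (val j))| ^+ 2 = \sum_(j < k.+1) a j ^+ 2.
Proof.
move=> Ik; apply: (norm_lincomb hdot (index_enum_uniq _)
  (u := fun j : 'I_k.+1 => e (inl (val j))) _ (fun j : 'I_k.+1 => a j)).
have Ij (j : 'I_k.+1) : I (inl (val j)).
  by apply: (active_initial hsp _ Ik); rewrite -ltnS ltn_ord.
move=> i j _ _ /=; rewrite (eigvec_orthonormal hsp (Ij i) (Ij j)).
have [->|ij] := eqVneq i j; first by rewrite eqxx.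
by case: eqP => // -[] /val_inj/eqP; rewrite (negbTE ij).
Qed.

Section Weighted.
Variable J : {fset nat}.
Hypothesis hJ0 : J != fset0.
Hypothesis hJ : forall k, k \in J -> active sp (inl k).
Hypothesis hgap : 0 < gap sp J.
Variables (a : R) (k : nat).
Hypothesis a01 : 0 <= a <= 1.
Hypothesis kJ : k \in J.

Local Notation O := (outside sp J).
Local Notation d := (distJ sp J).
Local Notation g := (gap sp J).
Local Notation P := (projJ dot sp J).
Local Notation V := (sqrtW dot sp J).

(** In this shape, as the form of a diagonal operator, the weight can be
    compared with [A] coordinate by coordinate. *)
Lemma weight_dotE x : g * `|P x| ^+ 2 + `|V x| ^+ 2 =
  dot (g *: P x + V (V x)) x.
Proof.
rewrite dotDl dotZl !hdot; congr (g * _ + _).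
  by rewrite -(projJ_sym hdot hsp hJ) (projJ_idem hsp hJ).
apply: (dot_eq_coord hdot (eigen_basis hsp)).
apply: (active_ind (J := J)) => [l lJ|m Om].
  by rewrite !(sqrtW_in hdot hsp hJ0 hJ _ lJ) !mul0r.
by rewrite !(sqrtW_out hdot hsp hJ0 hJ _ Om); ring.
Qed.

Lemma weight_coord_in x l : l \in J ->
  dot (e (inl l)) (g *: P x + V (V x)) = g * dot (e (inl l)) x.
Proof.
move=> lJ; rewrite dotDr dotZr (projJ_in hsp hJ _ lJ).
by rewrite (sqrtW_in hdot hsp hJ0 hJ _ lJ) addr0.
Qed.

Lemma weight_coord_out x m : O m ->
  dot (e m) (g *: P x + V (V x)) = d m * dot (e m) x.
Proof.
move=> Om; rewrite dotDr dotZr (projJ_out hsp hJ _ Om).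
rewrite !(sqrtW_out hdot hsp hJ0 hJ _ Om) mulr0 add0r mulrA -expr2.
by rewrite sqr_sqrtr// ltW// (distJ_gt0 hJ0 hgap).
Qed.

(** For an index [m] outside [J], [d_m] is at most the distance of the [m]-th
    eigenvalue to the [k]-th, so that subtracting [a d_m] with [a <= 1] leaves
    the former above the latter; only the entries in [J] can drop below it, by
    at most [a g]. *)
Lemma weighted_rayleigh_ge x :
  (forall i, I i -> dot (e i) x != 0 -> ev (inl k) <= ev i) ->
  (ev (inl k) - a * g) * `|x| ^+ 2 <=
    dot (A x) x - a * (g * `|P x| ^+ 2 + `|V x| ^+ 2).
Proof.
move=> hx; rewrite weight_dotE hdot -!dotZl -dotBl -subr_ge0 -dotBl.
apply: (dot_ge0_coord hdot (eigen_basis hsp)).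
apply: (active_ind (J := J)) => [l lJ|m Om].
  have Il := hJ lJ; rewrite !(dotBr, dotZr) dot_eigvec_op// weight_coord_in//.
  have [->|/(hx _ Il) kl] := eqVneq (dot (e (inl l)) x) 0;
    first by rewrite mulr0.
  rewrite [X in 0 <= X](_ : _ =
    (ev (inl l) - ev (inl k)) * dot (e (inl l)) x ^+ 2); last by ring.
  by rewrite mulr_ge0 ?sqr_ge0// subr_ge0.
have Im := outside_active Om.
rewrite !(dotBr, dotZr) dot_eigvec_op// weight_coord_out//.
have [->|/(hx _ Im) km] := eqVneq (dot (e m) x) 0; first by rewrite mulr0.
rewrite [X in 0 <= X](_ : _ =
  (ev m - ev (inl k) - a * d m + a * g) * dot (e m) x ^+ 2); last by ring.
rewrite mulr_ge0 ?sqr_ge0//; have := distJ_le sp m kJ.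
rewrite ger0_norm ?subr_ge0// => dm; case/andP: a01 => a0 a1.
have ag : 0 <= a * g by rewrite mulr_ge0// ltW.
have ad : a * d m <= d m by rewrite ler_piMl// ltW// (distJ_gt0 hJ0 hgap).
lra.
Qed.

(** Symmetrically, no eigenvalue from outside [J] is lifted above the
    [k]-th. *)
Lemma weighted_rayleigh_le x :
  (forall i, I i -> dot (e i) x != 0 -> ev i <= ev (inl k)) ->
  dot (A x) x + a * (g * `|P x| ^+ 2 + `|V x| ^+ 2) <=
    (ev (inl k) + a * g) * `|x| ^+ 2.
Proof.
move=> hx; rewrite weight_dotE hdot -!dotZl -dotDl -subr_ge0 -dotBl.
apply: (dot_ge0_coord hdot (eigen_basis hsp)).
apply: (active_ind (J := J)) => [l lJ|m Om].
  have Il := hJ lJ.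
  rewrite dotBr dotDr !dotZr dot_eigvec_op// weight_coord_in//.
  have [->|/(hx _ Il) kl] := eqVneq (dot (e (inl l)) x) 0;
    first by rewrite mulr0.
  rewrite [X in 0 <= X](_ : _ =
    (ev (inl k) - ev (inl l)) * dot (e (inl l)) x ^+ 2); last by ring.
  by rewrite mulr_ge0 ?sqr_ge0// subr_ge0.
have Im := outside_active Om.
rewrite dotBr dotDr !dotZr dot_eigvec_op// weight_coord_out//.
have [->|/(hx _ Im) km] := eqVneq (dot (e m) x) 0; first by rewrite mulr0.
rewrite [X in 0 <= X](_ : _ =
  (ev (inl k) - ev m - a * d m + a * g) * dot (e m) x ^+ 2); last by ring.
rewrite mulr_ge0 ?sqr_ge0//; have := distJ_le sp m kJ.
rewrite distrC ger0_norm ?subr_ge0// => dm; case/andP: a01 => a0 a1.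
have ag : 0 <= a * g by rewrite mulr_ge0// ltW.
have ad : a * d m <= d m by rewrite ler_piMl// ltW// (distJ_gt0 hJ0 hgap).
lra.
Qed.

End Weighted.
End Rayleigh.

Section EigenvalueShift.
Variables (R : realType) (H : completeNormedModType R).
Variable dot : {dot H for idfun}.
Hypothesis hdot : dot_norm_compatible dot.
Variables (A Ahat : {linear H -> H}).
Hypothesis (hA : self_adjoint dot A) (hAhat : self_adjoint dot Ahat).
Variables (CE : R) (E : {linear H -> H}).
Hypothesis hCE : forall x, `|E x| <= CE * `|x|.
Hypothesis AhatE : forall x, Ahat x = A x + E x.
Variables (sp sphat : eigensystem H).
Hypothesis hsp : is_eigensystem dot A sp.
Hypothesis hsphat : is_eigensystem dot Ahat sphat.
Variable J : {fset nat}.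
Hypothesis hJ : forall k, k \in J -> active sp (inl k).
Hypothesis hJhat : forall k, k \in J -> active sphat (inl k).
Hypothesis hgap : 0 < gap sp J.

(** The min-max argument. For the lower bound, take [x] in the span of the
    first unperturbed eigenvectors, up to the [k]-th, and orthogonal to the
    perturbed ones before the [k]-th; for the upper bound exchange the two
    systems. *)
Theorem eigenvalue_shift k : alpha dot sp J E <= 1 -> k \in J ->
  `|eigval sphat (inl k) - eigval sp (inl k)| <= alpha dot sp J E * gap sp J.
Proof.
move=> al1 kJ; have hJ0 : J != fset0 by apply/fset0Pn; exists k.
have al0 := alpha_ge0 hdot hsp hJ0 hJ hgap hCE.
have al01 : 0 <= alpha dot sp J E <= 1 by rewrite al0.
have quad x := quadratic_form_le hdot hsp hJ0 hJ hgap hCE x.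
have Ahatx x : dot (Ahat x) x = dot (A x) x + dot (E x) x.
  by rewrite AhatE dotDl.
rewrite ler_norml; apply/andP; split.
  have [a a0 xo] := exists_orthogonal_combination dot k
    (fun i => eigvec sp (inl i)) (fun i => eigvec sphat (inl i)).
  rewrite -(norm_eigvec_lincomb hdot hsp a (hJ kJ)) in a0.
  set x := \sum_(i < k.+1) _ in xo a0.
  have x0 : 0 < `|x| ^+ 2 by rewrite lt_def a0 sqr_ge0.
  have h1 := weighted_rayleigh_ge hdot hsp hA hJ0 hJ hgap al01 kJ
    (support_lincomb hsp (hJ kJ) (a := a)).
  have h2 := rayleigh_le hdot hsphat hAhat
    (support_orthogonal hsphat (hJhat kJ) xo).
  rewrite -/x in h1; rewrite -(ler_pM2r x0); move: (quad x); rewrite ler_norml.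
  by move=> /andP[q _]; rewrite Ahatx in h2; nra.
have [a a0 xo] := exists_orthogonal_combination dot k
  (fun i => eigvec sphat (inl i)) (fun i => eigvec sp (inl i)).
rewrite -(norm_eigvec_lincomb hdot hsphat a (hJhat kJ)) in a0.
set x := \sum_(i < k.+1) _ in xo a0.
have x0 : 0 < `|x| ^+ 2 by rewrite lt_def a0 sqr_ge0.
have h1 := weighted_rayleigh_le hdot hsp hA hJ0 hJ hgap al01 kJ
  (support_orthogonal hsp (hJ kJ) xo).
have h2 := rayleigh_ge hdot hsphat hAhat
  (support_lincomb hsphat (hJhat kJ) (a := a)).
rewrite -/x in h2; rewrite -(ler_pM2r x0); move: (quad x); rewrite ler_norml.
by move=> /andP[_ q]; rewrite Ahatx in h2; nra.
Qed.

End EigenvalueShift.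

(** * The Hilbert-Schmidt norm in beta *)

Section Beta.
Variables (R : realType) (H : completeNormedModType R).
Variable dot : {dot H for idfun}.
Hypothesis hdot : dot_norm_compatible dot.
Variables (A : H -> H) (sp : eigensystem H).
Hypothesis hsp : is_eigensystem dot A sp.
Variable J : {fset nat}.
Hypothesis hJ0 : J != fset0.
Hypothesis hJ : forall k, k \in J -> active sp (inl k).
Hypothesis hgap : 0 < gap sp J.
Variable E : {linear H -> H}.

Local Notation O := (outside sp J).
Local Notation P := (projJ dot sp J).
Local Notation S := (sqrtR dot sp J).
Local Notation g := (gap sp J).
Local Notation e := (eigvec sp).
Local Notation be := (beta dot sp J E).

Lemma projJ_eigvec l : l \in J -> P (e (inl l)) = e (inl l).
Proof.
move=> lJ; apply: (active_ext hsp (J := J)) => [k kJ|m Om].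
  by rewrite (projJ_in hsp hJ).
rewrite (projJ_out hsp hJ)//
  (eigvec_orthonormal hsp (outside_active Om) (hJ lJ)).
by case: eqP => // ml; case: (outside_notin lJ (sp := sp)); rewrite -ml.
Qed.

Lemma projJ_eigvec_out m : O m -> P (e m) = 0.
Proof.
move=> Om; rewrite projJE big_seq big1// => k kJ.
rewrite (eigvec_orthonormal hsp (hJ kJ) (outside_active Om)).
case: eqP => [mk|]; last by rewrite scale0r.
by case: (outside_notin kJ (sp := sp)); rewrite mk.
Qed.

Lemma hsnorm_SEP :
  hsnorm sp (S \o E \o P) ^+ 2 = \sum_(l <- J) `|S (E (e (inl l)))| ^+ 2.
Proof.
rewrite /hsnorm.
suff -> : (\esum_(i in active sp) (`|(S \o E \o P) (e i)| ^+ 2)%:E)%E =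
    (\sum_(l <- J) `|S (E (e (inl l)))| ^+ 2)%:E.
  by rewrite sqr_sqrtr// sumr_ge0// => l _; exact: sqr_ge0.
pose JJ := [set inl k | k in [set` J]] : set eigindex.
transitivity (\esum_(i in JJ) (`|(S \o E \o P) (e i)| ^+ 2)%:E)%E.
  have JJI : JJ `<=` active sp by move=> _ [k kJ <-]; exact: hJ.
  rewrite -[in RHS](setIidl JJI) esum_mkcondl; apply: eq_esum => i Ii.
  case: ifPn => // /negP; rewrite inE => nJ /=.
  rewrite projJ_eigvec_out; last by split.
  by rewrite linear0 (sqrtR0 hdot hsp hJ0 hJ hgap) normr0 expr0n.
have JJfin : finite_set JJ by apply: finite_image; exact: finite_fset.
rewrite esum_fset//.
rewrite fsbig_image/=; last by move=> x y _ _ [].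
rewrite fsbig_finite//= set_fsetK sumEFin; congr (_%:E).
by apply: eq_big_seq => l lJ; rewrite projJ_eigvec.
Qed.

Lemma sum_norm_SE : \sum_(l <- J) `|S (E (e (inl l)))| ^+ 2 = g * be ^+ 2.
Proof.
rewrite -hsnorm_SEP /beta exprMn mulrA exprVn (sqr_sqrtr (ltW hgap)).
by rewrite divff ?mul1r// gt_eqF.
Qed.

End Beta.

(** * Perturbed eigenvectors *)

Section Main.
Variables (R : realType) (H : completeNormedModType R).
Variable dot : {dot H for idfun}.
Hypothesis hdot : dot_norm_compatible dot.
Variables (A Ahat E : {linear H -> H}).
Hypothesis (hA : self_adjoint dot A) (hAhat : self_adjoint dot Ahat).
Variable CE : R.
Hypothesis hCE : forall x, `|E x| <= CE * `|x|.
Hypothesis AhatE : forall x, Ahat x = A x + E x.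
Variables (sp sphat : eigensystem H).
Hypothesis hsp : is_eigensystem dot A sp.
Hypothesis hsphat : is_eigensystem dot Ahat sphat.
Variable J : {fset nat}.
Hypothesis hJ0 : J != fset0.
Hypothesis hJ : forall k, k \in J -> active sp (inl k).
Hypothesis hJhat : forall k, k \in J -> active sphat (inl k).
Hypothesis hgap : 0 < gap sp J.
Hypothesis halpha : alpha dot sp J E <= 1 / 4.

Local Notation I := (active sp).
Local Notation O := (outside sp J).
Local Notation P := (projJ dot sp J).
Local Notation S := (sqrtR dot sp J).
Local Notation V := (sqrtW dot sp J).
Local Notation g := (gap sp J).
Local Notation d := (distJ sp J).
Local Notation e := (eigvec sp).
Local Notation ev := (eigval sp).
Local Notation al := (alpha dot sp J E).
Local Notation be := (beta dot sp J E).
Local Notation psi l := (e (inl l)).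
Local Notation psih k := (eigvec sphat (inl k)).
Local Notation lam l := (ev (inl l)).
Local Notation lamh k := (eigval sphat (inl k)).
Local Notation eP := (eigen_basis hsp).

Let al0 : 0 <= al := alpha_ge0 hdot hsp hJ0 hJ hgap hCE.

Lemma E_sym : self_adjoint dot E.
Proof.
move=> x y; have EE z : E z = Ahat z - A z by rewrite AhatE addrC addKr.
by rewrite !EE dotBl dotBr hAhat hA.
Qed.

(** The shift [alpha g] is at most [g / 4], hence at most a quarter of
    [d_m]. *)
Lemma perturbed_gap k m : k \in J -> O m -> 3 / 4 * d m <= `|lamh k - ev m|.
Proof.
move=> kJ Om; have al1 : al <= 1 by have := halpha; lra.
have := eigenvalue_shift hdot hA hAhat hCE AhatE hsp hsphat hJ hJhat hgap al1
  kJ.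
have := distJ_le sp m kJ; have := gap_le_distJ hJ0 Om.
have := ler_normB (lamh k - ev m) (lamh k - lam k).
rewrite (_ : _ - _ - _ = lam k - ev m) 1?(distrC (lam k)); last by ring.
have alg : al * g <= g / 4.
  by rewrite mulrC ler_wpM2l ?(ltW hgap)//; have := halpha; lra.
move=> *; lra.
Qed.

Lemma eigen_equation k i : k \in J -> I i ->
  (lamh k - ev i) * dot (e i) (psih k) = dot (e i) (E (psih k)).
Proof.
move=> kJ Ii; have := congr1 (dot (e i)) (AhatE (psih k)).
rewrite (eigvec_eigen hsphat (hJhat kJ)) dotDr dotZr.
by rewrite (dot_eigvec_op hsp hA)// mulrBl => ->; rewrite addrC addKr.
Qed.

Lemma norm_lincomb_J (a : nat -> R) :
  `|\sum_(l <- J) a l *: psi l| ^+ 2 = \sum_(l <- J) a l ^+ 2.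
Proof.
exact: (norm_lincomb hdot (fset_uniq J) (u := fun l => psi l)
  (inl_on_J hsp hJ)).
Qed.

Lemma psih_on_J : {in J &, forall k l, dot (psih k) (psih l) = (k == l)%:R}.
Proof. exact: (inl_on_J hsphat). Qed.

(** The leakage of the perturbed eigenvector out of [J] is of first order: the
    eigenvalue equation bounds [V x_k] by [S E x_k], in which the part with [V
    x_k] comes back with the factor [alpha <= 1/4] and is absorbed. *)
Lemma sqrtW_psih_le k : k \in J -> `|V (psih k)| <= 2 * `|S (E (P (psih k)))|.
Proof.
move=> kJ.
have h1 : `|V (psih k)| <= 4 / 3 * `|S (E (psih k))|.
  apply: (norm_le_coord hdot eP) => [|i]; first by rewrite divr_ge0.
  move: i; apply: (active_ind (J := J)) => [l lJ|m Om].
    by rewrite (sqrtW_in hdot hsp hJ0 hJ)// normr0 mulr_ge0//; lra.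
  rewrite (sqrtW_out hdot hsp hJ0 hJ)// (sqrtR_out hdot hsp hJ0 hgap)//.
  rewrite -(eigen_equation kJ (outside_active Om)) mulrA !normrM mulrA
    ler_wpM2r//.
  have d0 := distJ_gt0 hJ0 hgap Om.
  have sd0 : 0 < Num.sqrt (d m) by rewrite sqrtr_gt0.
  rewrite normfV (ger0_norm (ltW sd0)) mulrCA ler_pdivlMl//.
  rewrite -expr2 (sqr_sqrtr (ltW d0)); have := perturbed_gap kJ Om; lra.
have h2 : `|S (E (psih k))| <= `|S (E (P (psih k)))| + al * `|V (psih k)|.
  rewrite -{1}(projJ_sqrtR_sqrtW hdot hsp hJ0 hJ hgap (psih k)).
  rewrite linearD (sqrtRD hdot hsp hJ0 hJ hgap).
  apply: le_trans (ler_normD _ _) _; rewrite lerD2l.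
  exact: (norm_SES hdot hsp hJ0 hJ hgap hCE).
have h3 : al * `|V (psih k)| <= 1 / 4 * `|V (psih k)| by rewrite ler_wpM2r.
lra.
Qed.

Lemma sum_SEP_psih_le :
  \sum_(k <- J) `|S (E (P (psih k)))| ^+ 2 <= g * be ^+ 2.
Proof.
rewrite -(sum_norm_SE hdot hsp hJ0 hJ hgap) -[leRHS]mul1r -{1}(expr1n _ 2).
have SEPE k : S (E (P (psih k))) =
    \sum_(l <- J) dot (psih k) (psi l) *: S (E (psi l)).
  rewrite projJE linear_sum (big_morph _ (sqrtRD hdot hsp hJ0 hJ hgap)
    (sqrtR0 hdot hsp hJ0 hJ hgap)).
  apply: eq_bigr => l _; rewrite linearZ/= (sqrtRZ hdot hsp hJ0 hJ hgap).
  by rewrite (dotC dot).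
under eq_bigr do rewrite SEPE.
apply: (hs_contraction hdot _ eP (fset_uniq J) psih_on_J) => a.
by rewrite expr1n mul1r norm_lincomb_J.
Qed.

Lemma sum_sqrtW_psih_le :
  \sum_(k <- J) `|V (psih k)| ^+ 2 <= 4 * (g * be ^+ 2).
Proof.
apply: le_trans (ler_wpM2l _ sum_SEP_psih_le) => //; rewrite mulr_sumr.
rewrite big_seq [leRHS]big_seq; apply: ler_sum => k kJ.
rewrite (_ : 4 = 2 ^+ 2 :> R); last by rewrite -natrX.
by rewrite -exprMn ler_sqr ?nnegrE ?mulr_ge0// sqrtW_psih_le.
Qed.

(** * The first-order corrections *)

Definition correction (l : nat) : H := first_order dot sp J E l - psi l.
Local Notation G := correction.

Lemma correction_coord l i : l \in J -> I i ->
  dot (e i) (G l) = patch (fun=> 0) O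
    (fun m => dot (E (psi l)) (e m) / (lam l - ev m)) i.
Proof.
move=> lJ Ii; rewrite /correction /first_order addrC addKr.
apply: (sum_on_coord hdot eP (C := g^-1) (x := E (psi l))) => //.
- by move=> m /outside_active.
- by rewrite invr_ge0 ltW.
move=> m Om; rewrite (dotC dot) normrM mulrC ler_wpM2r// normfV.
have := gap_le lJ Om => gl; rewrite lef_pV2// posrE//.
exact: lt_le_trans gl.
Qed.

Lemma correction_in l l' : l \in J -> l' \in J -> dot (psi l') (G l) = 0.
Proof.
move=> lJ l'J; rewrite (correction_coord lJ (hJ l'J)) patchC// inE.
exact: outside_notin.
Qed.

Lemma diff_neq0 l m : l \in J -> O m -> lam l - ev m != 0.
Proof.
by move=> lJ Om; rewrite -normr_gt0; apply: lt_le_trans (gap_le lJ Om).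
Qed.

Lemma correction_out l m : l \in J -> O m ->
  (lam l - ev m) * dot (e m) (G l) = dot (e m) (E (psi l)).
Proof.
move=> lJ Om; rewrite (correction_coord lJ (outside_active Om)) patchT ?inE//.
by rewrite mulrC divfK ?diff_neq0// (dotC dot).
Qed.

Lemma sqrt_gap_le m (t : R) : O m -> d m <= `|t| ->
  (Num.sqrt (d m)) <= (Num.sqrt g)^-1 * `|t|.
Proof.
move=> Om dt; have sg0 : 0 < Num.sqrt g by rewrite sqrtr_gt0.
rewrite ler_pdivlMl//; apply: le_trans dt.
rewrite -[X in _ <= X](sqr_sqrtr (ltW (distJ_gt0 hJ0 hgap Om))) expr2.
by rewrite ler_wpM2r ?sqrtr_ge0// ler_wsqrtr// gap_le_distJ.
Qed.

(** Within a common eigenvalue [mu] the denominators [mu - lam_m] do not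
    depend on [l], so that the sum is a diagonal operator applied to [E (sum_l
    a_l e_l)]. *)
Lemma correction_group_le (mu : R) (a : nat -> R) :
  (exists2 l, l \in J & mu = lam l) ->
  `|\sum_(l <- J | lam l == mu) a l *: G l| <=
    (Num.sqrt g)^-1 * `|S (E (\sum_(l <- J | lam l == mu) a l *: psi l))|.
Proof.
move=> [l0 l0J mul0]; have sg0 : 0 < Num.sqrt g by rewrite sqrtr_gt0.
apply: (norm_le_coord hdot eP) => [|i]; first by rewrite invr_ge0 ltW.
move: i; apply: (active_ind (J := J)) => [k kJ|m Om].
  rewrite dot_sumr big_seq_cond big1 ?normr0 ?mulr_ge0 ?invr_ge0 ?(ltW sg0)//.
  by move=> l /andP[lJ _]; rewrite dotZr correction_in// mulr0.
rewrite (sqrtR_out hdot hsp hJ0 hgap)//.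
have -> : dot (e m) (E (\sum_(l <- J | lam l == mu) a l *: psi l)) =
    (mu - ev m) * dot (e m) (\sum_(l <- J | lam l == mu) a l *: G l).
  rewrite linear_sum !dot_sumr mulr_sumr big_seq_cond [RHS]big_seq_cond.
  apply: eq_bigr => l /andP[lJ /eqP <-].
  by rewrite linearZ/= !dotZr -correction_out//; ring.
rewrite !normrM mulrA mulrA -[leLHS]mul1r ler_wpM2r//.
have sd0 : 0 < Num.sqrt (d m) by rewrite sqrtr_gt0 (distJ_gt0 hJ0 hgap).
rewrite normfV (ger0_norm (ltW sd0)) mulrCA ler_pdivlMl// mulr1.
apply: sqrt_gap_le => //; rewrite mul0 distrC; exact: distJ_le.
Qed.

Lemma sum_norm_correction_le : \sum_(l <- J) `|G l| ^+ 2 <= be ^+ 2.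
Proof.
have -> : be ^+ 2 = g^-1 * \sum_(l <- J) `|S (E (psi l))| ^+ 2.
  by rewrite (sum_norm_SE hdot hsp hJ0 hJ hgap) mulKf// gt_eqF.
rewrite mulr_sumr big_seq [leRHS]big_seq; apply: ler_sum => l lJ.
have sg0 : 0 < Num.sqrt g by rewrite sqrtr_gt0.
rewrite -[X in X^-1](sqr_sqrtr (ltW hgap)) -exprVn -exprMn.
rewrite ler_sqr ?nnegrE ?mulr_ge0 ?invr_ge0 ?(ltW sg0)//.
apply: (norm_le_coord hdot eP) => [|i]; first by rewrite invr_ge0 ltW.
move: i; apply: (active_ind (J := J)) => [k kJ|m Om].
  by rewrite correction_in// normr0 mulr_ge0// invr_ge0 ltW.
rewrite (sqrtR_out hdot hsp hJ0 hgap)// -correction_out//.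
rewrite !normrM mulrA mulrA -[leLHS]mul1r ler_wpM2r//.
have sd0 : 0 < Num.sqrt (d m) by rewrite sqrtr_gt0 (distJ_gt0 hJ0 hgap).
rewrite normfV (ger0_norm (ltW sd0)) mulrCA ler_pdivlMl// mulr1.
by apply: sqrt_gap_le => //; rewrite distrC; exact: distJ_le.
Qed.

(** One application of [correction_group_le] for each distinct eigenvalue; the
    components of [sum_l a_l e_l] in the different groups are orthogonal, and
    Cauchy-Schwarz over the groups costs the factor [ndistinct]. *)
Lemma norm_sum_correction_le (a : nat -> R) :
  `|\sum_(l <- J) a l *: G l| ^+ 2 <=
    (ndistinct sp J)%:R * al ^+ 2 * \sum_(l <- J) a l ^+ 2.
Proof.
set vals := [fset lam l | l in J]%fset.
pose y mu := \sum_(l <- J | lam l == mu) a l *: psi l.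
have sg0 : 0 < Num.sqrt g by rewrite sqrtr_gt0.
have group_le mu : mu \in vals ->
    `|\sum_(l <- J | lam l == mu) a l *: G l| <= al * `|y mu|.
  case/imfsetP => l /= lJ mul.
  apply: le_trans (correction_group_le _ _) _; first by exists l.
  rewrite ler_pdivrMl// -/(y mu); have Py : P (y mu) = y mu.
    apply: (active_ext hsp (J := J)) => [k kJ|m Om].
      by rewrite (projJ_in hsp hJ).
    rewrite (projJ_out hsp hJ)// dot_sumr big_seq_cond big1// => k /andP[kJ _].
    rewrite dotZr -(projJ_eigvec hsp hJ kJ) (projJ_out hsp hJ _ Om) mulr0//.
  rewrite -[in leLHS]Py mulrA (mulrC (Num.sqrt g)).
  exact: (norm_SEP hdot hsp hJ0 hJ hgap hCE).
rewrite (partition_big_imfset _ (fun l => lam l))/= -/vals.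
apply: (@le_trans _ _ ((\sum_(mu <- vals) al * `|y mu|) ^+ 2)).
  rewrite ler_sqr ?nnegrE//; last by apply: sumr_ge0 => mu _; rewrite mulr_ge0.
  apply: le_trans (ler_norm_sum _ _ _) _.
  by rewrite big_seq [leRHS]big_seq; apply: ler_sum.
apply: le_trans (sqr_sum_le _ _) _; rewrite -mulrA ler_wpM2l//.
rewrite [in leRHS](partition_big_imfset _ (fun l => lam l))/= -/vals mulr_sumr.
apply: ler_sum => mu _; rewrite exprMn ler_wpM2l ?sqr_ge0//.
rewrite /y -!(big_filter _ (fun l => lam l == mu)).
rewrite (norm_lincomb hdot _ (u := fun l => psi l))//.
  by rewrite filter_uniq ?fset_uniq.
move=> k l; rewrite !mem_filter => /andP[_ kJ] /andP[_ lJ].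
exact: (inl_on_J hsp hJ).
Qed.

(** The coefficients come from the bounded block [P E P] applied to an
    orthonormal family, while the corrections are small in the Hilbert-Schmidt
    norm, so that [hs_contraction] applies. *)
Lemma sum_correction_PEP_le :
  \sum_(k <- J) `|\sum_(l <- J) dot (psi l) (E (P (psih k))) *: G l| ^+ 2 <=
    (al * g * be) ^+ 2.
Proof.
have -> :
    \sum_(k <- J) `|\sum_(l <- J) dot (psi l) (E (P (psih k))) *: G l| ^+ 2 =
    \sum_(k <- J) `|\sum_(l <- J) dot (psih k) (P (E (psi l))) *: G l| ^+ 2.
  apply: eq_bigr => k _; congr (`|_| ^+ 2); apply: eq_bigr => l _.
  by rewrite -E_sym -(projJ_sym hdot hsp hJ) (dotC dot).
apply: le_trans (hs_contraction hdot _ eP (fset_uniq J) psih_on_J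
  (C := al * g) _) _.
  move=> a; set y := \sum_(l <- J) a l *: psi l.
  have -> : \sum_(l <- J) a l *: P (E (psi l)) = P (E (P y)).
    have P0 : P 0 = 0.
      by apply: (addrI (P 0)); rewrite -(projJD hsp hJ) !addr0.
    have -> : P y = y.
      rewrite /y (big_morph _ (projJD hsp hJ) P0).
      apply: eq_big_seq => l lJ.
      by rewrite (projJZ hsp hJ) (projJ_eigvec hsp hJ).
    rewrite /y linear_sum (big_morph _ (projJD hsp hJ) P0).
    by apply: eq_bigr => l _; rewrite linearZ/= (projJZ hsp hJ).
  rewrite -norm_lincomb_J.
  rewrite -exprMn ler_sqr ?nnegrE ?mulr_ge0//; last exact: ltW.
  exact: (norm_PEP hdot hsp hJ0 hJ hgap hCE).
by rewrite [leRHS]exprMn ler_wpM2l ?sqr_ge0// sum_norm_correction_le.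
Qed.

Lemma E_projJ x : E (P x) = \sum_(l <- J) dot (psi l) x *: E (psi l).
Proof.
by rewrite projJE linear_sum; apply: eq_bigr => l _; rewrite linearZ.
Qed.

Lemma E_sub_projJ x : E (x - P x) = E (S (V x)).
Proof.
rewrite -{1}(projJ_sqrtR_sqrtW hdot hsp hJ0 hJ hgap x).
by rewrite addrAC subrr add0r.
Qed.

Lemma norm_sum_correction_PES_le x :
  `|\sum_(l <- J) dot (psi l) (E (S (V x))) *: G l| <=
    Num.sqrt (ndistinct sp J)%:R * (al ^+ 2 * Num.sqrt g * `|V x|).
Proof.
have sg0 := sqrtr_ge0 g.
rewrite -ler_sqr ?nnegrE ?mulr_ge0 ?sqr_ge0 ?sqrtr_ge0//.
apply: le_trans (norm_sum_correction_le _) _.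
rewrite exprMn sqr_sqrtr ?ler0n// -mulrA ler_wpM2l ?ler0n//.
rewrite -norm_lincomb_J.
rewrite -projJE -exprMn ler_sqr ?nnegrE ?mulr_ge0 ?sqr_ge0//.
rewrite (_ : al ^+ 2 * _ * _ = al * (al * Num.sqrt g * `|V x|)); last by ring.
by rewrite ler_wpM2l// (norm_PES hdot hsp hJ0 hJ hgap hCE).
Qed.

(** * The residual of the first-order expansion *)

Definition residual (k : nat) : H :=
  psih k - \sum_(l <- J) dot (psih k) (psi l) *: first_order dot sp J E l.

Lemma residual_in k l : k \in J -> l \in J -> dot (psi l) (residual k) = 0.
Proof.
move=> kJ lJ; rewrite /residual dotBr.
have -> : \sum_(j <- J) dot (psih k) (psi j) *: first_order dot sp J E j =
    \sum_(j <- J) dot (psih k) (psi j) *: psi j +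
    \sum_(j <- J) dot (psih k) (psi j) *: G j.
  rewrite -big_split/=; apply: eq_bigr => j _.
  by rewrite -scalerDr /correction addrC subrK.
rewrite dotDr (dot_lincomb (fset_uniq J) (inl_on_J hsp hJ))// dot_sumr.
rewrite big_seq big1 ?addr0; last first.
  by move=> j jJ; rewrite dotZr correction_in// mulr0.
by rewrite (dotC dot) subrr.
Qed.

(** The terms of first order cancel: for [l] in [J], [(lamhat_k - lam_m) <e_m,
    G_l> = <e_m, E e_l> + (lamhat_k - lam_l) <e_m, G_l>], and the eigenvalue
    equation at [l] turns [(lamhat_k - lam_l) <e_l, x_k>] into [<e_l, E
    x_k>]. *)
Lemma residual_out k m : k \in J -> O m ->
  (lamh k - ev m) * dot (e m) (residual k) =
  dot (e m) (E (S (V (psih k))) -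
    \sum_(l <- J) dot (psi l) (E (psih k)) *: G l).
Proof.
move=> kJ Om; rewrite /residual dotBr mulrBr.
rewrite (eigen_equation kJ (outside_active Om)).
rewrite dotBr -E_sub_projJ linearB/= dotBr -!addrA; congr (_ + _).
rewrite -opprD; congr (- _).
rewrite E_projJ !dot_sumr mulr_sumr -big_split/=.
apply: eq_big_seq => l lJ; rewrite !dotZr.
have -> : first_order dot sp J E l = psi l + G l.
  by rewrite /correction addrC subrK.
rewrite dotDr (eigvec_orthonormal hsp (outside_active Om) (hJ lJ)).
rewrite (_ : m == inl l = false); last first.
  by apply/eqP => ml; case: (outside_notin lJ (sp := sp)); rewrite -ml.
rewrite mulr0n add0r -(eigen_equation kJ (hJ lJ)) -correction_out//.
rewrite (dotC dot (psih k)).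
ring.
Qed.

(** The resolvent of the unperturbed operator at the perturbed eigenvalue,
    restricted to the complement of [J]. *)
Definition resolvent (k : nat) : H -> H :=
  multiplier dot I e (patch (fun=> 0) O (fun m => (lamh k - ev m)^-1)).

Lemma perturbed_diff_gt0 k m : k \in J -> O m -> 0 < `|lamh k - ev m|.
Proof.
move=> kJ Om; apply: lt_le_trans (perturbed_gap kJ Om).
by rewrite mulr_gt0 ?divr_gt0// (distJ_gt0 hJ0 hgap).
Qed.

Lemma resolvent_bound k i : k \in J ->
  `|patch (fun=> 0) O (fun m => (lamh k - ev m)^-1) i| <= 4 / 3 * g^-1.
Proof.
move=> kJ; have [Oi|Oi] := pselect (O i); last first.
  by rewrite patchC ?inE// normr0 mulr_ge0 ?divr_ge0// invr_ge0 ltW.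
rewrite patchT ?inE// normfV -[4 / 3]invrK -invfM.
have g43 : 0 < (4 / 3)^-1 * g by rewrite mulr_gt0// invr_gt0 divr_gt0.
rewrite lef_pV2 ?posrE ?perturbed_diff_gt0//.
apply: le_trans (perturbed_gap kJ Oi); rewrite invf_div.
by rewrite ler_wpM2l ?divr_ge0// gap_le_distJ.
Qed.

Lemma resolvent_coord k x i : k \in J -> I i ->
  dot (e i) (resolvent k x) =
  patch (fun=> 0) O (fun m => (lamh k - ev m)^-1) i * dot (e i) x.
Proof.
move=> kJ; apply: (multiplier_coord hdot eP (C := 4 / 3 * g^-1)) => j _.
exact: resolvent_bound.
Qed.

Lemma norm_resolvent_le k x : k \in J ->
  `|resolvent k x| <= 4 / 3 * g^-1 * `|x|.
Proof.
move=> kJ; apply: (norm_le_coord hdot eP) => [|i Ii].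
  by rewrite mulr_ge0 ?divr_ge0// invr_ge0 ltW.
by rewrite resolvent_coord// normrM ler_wpM2r// resolvent_bound.
Qed.

(** The denominator is at least [3/4 d_m]. Half of it, [sqrt d_m], is kept as
    the weight [S], and the other half is at least [sqrt g]. *)
Lemma norm_resolvent_sqrtR_le k x : k \in J ->
  `|resolvent k x| <= 4 / 3 * (Num.sqrt g)^-1 * `|S x|.
Proof.
have sg0 : 0 < Num.sqrt g by rewrite sqrtr_gt0.
move=> kJ; apply: (norm_le_coord hdot eP) => [|i].
  by rewrite mulr_ge0 ?divr_ge0// invr_ge0 ltW.
move: i; apply: (active_ind (J := J)) => [l lJ|m Om].
  rewrite resolvent_coord//; last exact: hJ.
  rewrite patchC ?inE ?mul0r ?normr0 ?mulr_ge0 ?divr_ge0 ?invr_ge0 ?(ltW sg0)//.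
  exact: outside_notin.
rewrite resolvent_coord//; last exact: outside_active Om.
rewrite patchT ?inE// (sqrtR_out hdot hsp hJ0 hgap)// !normrM mulrA.
rewrite ler_wpM2r// !normfV.
have d0 := distJ_gt0 hJ0 hgap Om.
have sd0 : 0 < Num.sqrt (d m) by rewrite sqrtr_gt0.
rewrite (ger0_norm (ltW sd0)).
have h : 3 / 4 * (Num.sqrt g * Num.sqrt (d m)) <= `|lamh k - ev m|.
  apply: le_trans (perturbed_gap kJ Om); rewrite ler_wpM2l ?divr_ge0//.
  rewrite -[leRHS](sqr_sqrtr (ltW d0)) expr2 ler_wpM2r ?sqrtr_ge0//.
  by rewrite ler_wsqrtr// gap_le_distJ.
rewrite -[4 / 3]invrK -!invfM lef_pV2 ?posrE ?perturbed_diff_gt0//; last first.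
  by rewrite !mulr_gt0// invr_gt0 divr_gt0.
by apply: le_trans h; rewrite invf_div mulrA.
Qed.

Lemma residual_resolvent k : k \in J ->
  residual k = resolvent k (E (S (V (psih k)))) -
    (resolvent k (\sum_(l <- J) dot (psi l) (E (P (psih k))) *: G l) +
     resolvent k (\sum_(l <- J) dot (psi l) (E (S (V (psih k)))) *: G l)).
Proof.
move=> kJ; apply: (active_ext hsp (J := J)) => [l lJ|m Om].
  rewrite residual_in// dotBr dotDr !resolvent_coord//; try exact: hJ.
  by rewrite patchC ?inE; [ring|exact: outside_notin].
have c0 : lamh k - ev m != 0 by rewrite -normr_gt0 perturbed_diff_gt0.
apply: (mulfI c0); rewrite residual_out// !dotBr dotDr.
rewrite !resolvent_coord//; try exact: outside_active Om.
rewrite patchT ?inE// -!mulrDr -!mulrBr mulVKf//.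
congr (_ - _); rewrite -dotDr; congr (dot _ _).
rewrite -big_split/=; apply: eq_bigr => l _; rewrite -scalerDl -dotDr.
by rewrite -linearD (projJ_sqrtR_sqrtW hdot hsp hJ0 hJ hgap).
Qed.

Local Notation sD := (Num.sqrt (ndistinct sp J)%:R : R).

Lemma norm_residual_le k : k \in J ->
  `|residual k| <=
    4 / 3 * g^-1 * `|\sum_(l <- J) dot (psi l) (E (P (psih k))) *: G l| +
    4 / 3 * (sD / 4 + 1) * (al * ((Num.sqrt g)^-1 * `|V (psih k)|)).
Proof.
move=> kJ; rewrite residual_resolvent//.
set Z := \sum_(l <- J) _; set Y := \sum_(l <- J) _; set w := V (psih k).
have sg0 : 0 < Num.sqrt g by rewrite sqrtr_gt0.
have hZ := norm_resolvent_le Z kJ; have hY := norm_resolvent_le Y kJ.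
have hw := norm_resolvent_sqrtR_le (E (S w)) kJ.
apply: le_trans (ler_normB _ _) _; rewrite addrC.
apply: le_trans (lerD (ler_normD _ _) (lexx _)) _.
rewrite -addrA; apply: lerD; first exact: hZ.
set N := al * (_ * `|w|).
rewrite (_ : 4 / 3 * (sD / 4 + 1) * N = 4 / 3 * (sD / 4 * N) + 4 / 3 * N);
  last by ring.
apply: lerD.
  apply: le_trans hY _; rewrite -mulrA ler_wpM2l ?divr_ge0//.
  rewrite ler_pdivrMl//; apply: le_trans (norm_sum_correction_PES_le _) _.
  rewrite -/w [leRHS](_ : _ = sD * (al * (1 / 4) * (Num.sqrt g * `|w|)));
    last first.
    rewrite -[X in X * _](sqr_sqrtr (ltW hgap)) /N; field.
    by rewrite gt_eqF.
  rewrite ler_wpM2l ?sqrtr_ge0// -mulrA expr2.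
  by rewrite ler_wpM2r ?mulr_ge0 ?sqrtr_ge0// ler_wpM2l.
apply: le_trans hw _; rewrite -mulrA ler_wpM2l ?divr_ge0//.
rewrite /N mulrCA ler_wpM2l ?invr_ge0 ?sqrtr_ge0//.
exact: (norm_SES hdot hsp hJ0 hJ hgap hCE).
Qed.

(** In the last step [(p + q) ^ 2 <= 2 p ^ 2 + 2 q ^ 2] separates the term
    that is summed in the Hilbert-Schmidt norm from those controlled by [V
    x_k]; with [s = sqrt D] there remains [32/9 + 128/9 (s/4 + 1)^2 <= (74 s /
    9 + 8)^2]. *)
Theorem sum_residual_le :
  Num.sqrt (\sum_(k <- J) `|residual k| ^+ 2) <= (74 * sD / 9 + 8) * al * be.
Proof.
have sg0 : 0 < Num.sqrt g by rewrite sqrtr_gt0.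
have sD0 : 0 <= sD by exact: sqrtr_ge0.
have be0 : 0 <= be by rewrite mulr_ge0 ?invr_ge0 ?sqrtr_ge0.
have c0 : 0 <= (74 * sD / 9 + 8) * al * be.
  by apply: mulr_ge0 => //; apply: mulr_ge0 => //; have := sD0; lra.
rewrite -[leRHS](ger0_norm c0) -sqrtr_sqr ler_wsqrtr//.
pose za k := `|\sum_(l <- J) dot (psi l) (E (P (psih k))) *: G l|.
pose v k := `|V (psih k)|.
apply: (@le_trans _ _ (2 * (4 / 3 * g^-1) ^+ 2 * \sum_(k <- J) za k ^+ 2 +
    2 * (4 / 3 * (sD / 4 + 1) * al * (Num.sqrt g)^-1) ^+ 2
      * \sum_(k <- J) v k ^+ 2)).
  rewrite !mulr_sumr -big_split/= big_seq [leRHS]big_seq;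
    apply: ler_sum => k kJ.
  have := norm_residual_le kJ; rewrite -/(za k) -/(v k).
  set s1 := _ * za k; set s2 := _ * (al * _) => h.
  have n0 := normr_ge0 (residual k).
  have h2 : `|residual k| ^+ 2 <= (s1 + s2) ^+ 2.
    by rewrite ler_sqr ?nnegrE// (le_trans n0).
  apply: le_trans h2 _.
  rewrite [leRHS](_ : _ = 2 * s1 ^+ 2 + 2 * s2 ^+ 2); last first.
    by rewrite /s1 /s2; ring.
  have := sqr_ge0 (s1 - s2); nra.
have hza : 2 * (4 / 3 * g^-1) ^+ 2 * \sum_(k <- J) za k ^+ 2 <=
    32 / 9 * (al * be) ^+ 2.
  apply: le_trans (ler_wpM2l _ sum_correction_PEP_le) _.
    by rewrite mulr_ge0 ?sqr_ge0.
  rewrite [leLHS](_ : _ = 32 / 9 * (al * be) ^+ 2)//.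
  by field; rewrite gt_eqF.
have hv : 2 * (4 / 3 * (sD / 4 + 1) * al * (Num.sqrt g)^-1) ^+ 2
      * \sum_(k <- J) v k ^+ 2 <= 128 / 9 * (sD / 4 + 1) ^+ 2 * (al * be) ^+ 2.
  apply: le_trans (ler_wpM2l _ sum_sqrtW_psih_le) _.
    by rewrite mulr_ge0 ?sqr_ge0.
  rewrite -[X in 4 * (X * _)](sqr_sqrtr (ltW hgap)).
  rewrite [leLHS](_ : _ = 128 / 9 * (sD / 4 + 1) ^+ 2 * (al * be) ^+ 2)//.
  by field; rewrite gt_eqF.
apply: le_trans (lerD hza hv) _; rewrite -mulrDl.
rewrite [leRHS](_ : _ = (74 * sD / 9 + 8) ^+ 2 * (al * be) ^+ 2); last by ring.
rewrite ler_wpM2r ?sqr_ge0//; nra.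
Qed.

End Main.

Theorem theorem3p7 (R : realType) (H : completeNormedModType R)
    (dot : {dot H for idfun}) (hdot : dot_norm_compatible dot)
    (hsep : separable H)
    (A Ahat : {linear H -> H})
    (hA : compact_operator A) (hA_sa : self_adjoint dot A)
    (hA_ge0 : eigenvalues_ge0 A)
    (hAhat : compact_operator Ahat) (hAhat_sa : self_adjoint dot Ahat)
    (hAhat_ge0 : eigenvalues_ge0 Ahat)
    (sp sphat : eigensystem H)
    (hsp : is_eigensystem dot A sp) (hsphat : is_eigensystem dot Ahat sphat)
    (J : {fset nat}) (hJ0 : J != fset0)
    (hJ : forall k, k \in J -> active sp (inl k))
    (hJhat : forall k, k \in J -> active sphat (inl k))
    (hgap : 0 < gap sp J)
    (halpha : alpha dot sp J (Ahat \- A) <= 1 / 4) :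
  Num.sqrt (\sum_(k <- J)
      `| eigvec sphat (inl k)
         - \sum_(l <- J) dot (eigvec sphat (inl k)) (eigvec sp (inl l))
             *: first_order dot sp J (Ahat \- A) l | ^+ 2)
  <= (74 * Num.sqrt (ndistinct sp J)%:R / 9 + 8)
     * alpha dot sp J (Ahat \- A) * beta dot sp J (Ahat \- A).
Proof.
have [C _ hC] := compact_operator_bounded hA.
have [Chat _ hChat] := compact_operator_bounded hAhat.
have hE x : `|(Ahat \- A) x| <= (Chat + C) * `|x|.
  by rewrite mulrDl; apply: le_trans (ler_normB _ _) _; exact: lerD.
have AhatE x : Ahat x = A x + (Ahat \- A) x by rewrite /= addrC subrK.
exact: (sum_residual_le hdot hA_sa hAhat_sa hE AhatE hsp hsphat hJ0 hJ hJhat).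
Qed.
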